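(* Let $a=(a(m))_{m\in\mathbb{Z}}\in\mathbb{C}^{\mathbb{Z}}$ satisfy $a(0)=0$, $a(m)=\overline{a(-m)}$ for all $m\in\mathbb{Z}$, and $a\in\ell^1_{r}(\mathbb{Z})$ for some real $r\ge 0$, i.e. $\|a\|_r=\sum_{m\in\mathbb{Z}}|a(m)||m|^r<+\infty$. Let $\mathcal{L}_0$ be the self-adjoint operator in $\ell^2(\mathbb{Z})$ with domain $\{u\in\ell^2(\mathbb{Z}):\sum_{n\in\mathbb{Z}}|n|^2|u(n)|^2<+\infty\}$ and $$(\mathcal{L}_0u)(n)=\sum_{m\in\mathbb{Z}}a(n-m)u(m)+n\,u(n),\quad n\in\mathbb{Z}.$$ Let $b\in\ell^\infty(\mathbb{Z},\mathbb{R})$ and consider $\mathcal{L}_0+b$, where $b$ acts as a multiplication operator. Let $\{\lambda_n\}_{n\in\mathbb{Z}}$ be the eigenvalues of $\mathcal{L}_0+b$, enumerated as described in the context. Then: (i) there exists $\gamma>0$ such that $|\lambda_n-n|\le\gamma$ for all $n\in\mathbb{Z}$; (ii) if $a\in\ell^1_r(\mathbb{Z})$ with $r\in\mathbb{N}\cup\{0\}$, then any orthonormal basis $\{\phi_m\}_{m\in\mathbb{Z}}$ of $\ell^2(\mathbb{Z})$ consisting of eigenfunctions of $\mathcal{L}_0+b$, with $(\mathcal{L}_0+b)\phi_m=\lambda_m\phi_m$ for each $m\in\mathbb{Z}$, satisfies $$|\phi_m(n)|\le\frac{\gamma_r}{|n-m|^{r+1}},\qquad m,n\in\mathbb{Z},\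 n\ne m,$$ where $\gamma_r$ is a constant that depends only on $r$ and $\|a\|_r$; (iii) if $a\in\ell^1_r(\mathbb{Z})$ with $r\in\mathbb{N}\cup\{0\}$ and $0<q<2r-1$, then for every $k\in\mathbb{Z}$, with $\psi=\delta_k$, $$\sup_{t\in\mathbb{R}}\sum_{n\in\mathbb{Z}}|n|^q\,|\langle e^{-i(\mathcal{L}_0+b)t}\psi,\delta_n\rangle|^2<+\infty.$$
   Context: $\{\delta_n\}_{n\in\mathbb{Z}}$ is the canonical orthonormal basis of $\ell^2(\mathbb{Z})$, and $\ell^\infty(\mathbb{Z},\mathbb{R})$ is the space of bounded real sequences on $\mathbb{Z}$. For $r\ge 0$, $a\in\ell^1_r(\mathbb{Z})$ means $\|a\|_r=\sum_{m\in\mathbb{Z}}|a(m)||m|^r<+\infty$ (recall $a(0)=0$, so the $m=0$ term is $0$). The operator $\mathcal{L}_0+b$ is self-adjoint with purely discrete spectrum (its spectrum consists of isolated eigenvalues of finite multiplicity), and its eigenvalues are unbounded above and below. They are enumerated with multiplicity in nondecreasing order as $\dots\le\lambda_{-2}\le\lambda_{-1}\le\lambda_0\le\lambda_1\le\lambda_2\le\dots$, with $\lambda_n\to\pm\infty$ as $n\to\pm\infty$, where $\lambda_0=\min\{\lambda_n:\lambda_n\ge 0\}$.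
   Formalization: In (ii) the constant γ_r may also depend on the fixed sequence b; independence of b is false (a=0, b(0)=M, b(M)=-M and b=0 elsewhere gives λ_0=0 with eigenfunction δ_M, forcing γ_r ≥ M^{r+1}). *)

(* Defs.v *)
From HB Require Import structures.
From mathcomp Require Import all_boot all_order all_algebra.
From mathcomp Require Import all_classical all_reals all_analysis.
From mathcomp Require Import complex.
Import Order.TTheory GRing.Theory Num.Theory.
Import numFieldNormedType.Exports.

Set Implicit Arguments.
Unset Strict Implicit.
Unset Printing Implicit Defensive.

Local Open Scope classical_set_scope.
Local Open Scope card_scope.
Local Open Scope ring_scope.
Local Open Scope complex_scope.

Section Defs.
Variable R : realType.

(* The norm on R[i] provided by the numDomainType structure takes values in
   R[i]; this is the same modulus with values in R. *)
Definition cmod (z : R[i]) : R := ComplexField.Normc.normc z.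

(* Unconditional sums over Z. They are meaningful for absolutely summable
   families only, which is the case at all the places where they are used. *)
Definition sumZ (f : int -> R) : R :=
  fine (\esum_(n in [set: int]) (Num.max (f n) 0)%:E) -
  fine (\esum_(n in [set: int]) (Num.max (- f n) 0)%:E).

Definition csumZ (f : int -> R[i]) : R[i] :=
  sumZ (fun n => complex.Re (f n)) +i* sumZ (fun n => complex.Im (f n)).

(* || a ||_r. At m = 0 the weight is 0 `^ r, which is 1 for r = 0; this plays
   no role since a 0 = 0. *)
Definition wnorm1 (r : R) (a : int -> R[i]) : \bar R :=
  \esum_(m in [set: int]) (cmod (a m) * `|m%:~R| `^ r)%:E.

Definition ell1 (r : R) : set (int -> R[i]) :=
  [set a | (wnorm1 r a < +oo)%E].

Definition ell2 : set (int -> R[i]) :=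
  [set u | (\esum_(n in [set: int]) (cmod (u n) ^+ 2)%:E < +oo)%E].

Definition norm2 (u : int -> R[i]) : R :=
  Num.sqrt (fine (\esum_(n in [set: int]) (cmod (u n) ^+ 2)%:E)).

Definition inner (u v : int -> R[i]) : R[i] :=
  csumZ (fun n => u n * conjc (v n)).

Definition delta (k : int) : int -> R[i] := fun n => (n == k)%:R.

Definition orthonormal_basis (phi : int -> int -> R[i]) : Prop :=
  [/\ forall m, ell2 (phi m),
      forall m k, inner (phi m) (phi k) = (m == k)%:R
    & forall u, ell2 u -> (forall m, inner u (phi m) = 0) ->
        forall n, u n = 0].

Definition domL0 : set (int -> R[i]) :=
  [set u | ell2 u /\
    (\esum_(n in [set: int]) (`|n%:~R| ^+ 2 * cmod (u n) ^+ 2)%:E < +oo)%E].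

Definition L0 (a u : int -> R[i]) : int -> R[i] :=
  fun n => csumZ (fun m => a (n - m) * u m) + n%:~R * u n.

(* L0 + b, with domain domL0. *)
Definition L0b (a : int -> R[i]) (b : int -> R) (u : int -> R[i]) :
  int -> R[i] := fun n => L0 a u n + (b n)%:C * u n.

(* The kernel of H - z, for H an operator with domain D. *)
Definition eigspace (D : set (int -> R[i]))
    (H : (int -> R[i]) -> int -> R[i]) (z : R[i]) : set (int -> R[i]) :=
  [set u | D u /\ forall n, H u n = z * u n].

Definition has_dim (E : set (int -> R[i])) (k : nat) : Prop :=
  exists2 e : 'I_k -> int -> R[i], (forall i, E (e i)) &
    forall u, E u ->
      exists! c : {ffun 'I_k -> R[i]}, forall n, u n = \sum_i c i * e i n.

(* lam lists the eigenvalues of H with multiplicity: every z : R[i] occurs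
   dim ker (H - z) times (so 0 times if z is not an eigenvalue). *)
Definition eigenvalue_enum (D : set (int -> R[i]))
    (H : (int -> R[i]) -> int -> R[i]) (lam : int -> R) : Prop :=
  [/\ forall z : R[i], exists2 k : nat,
        [set n | (lam n)%:C = z] #= `I_k & has_dim (eigspace D H z) k,
      forall m n : int, m <= n -> lam m <= lam n,
      forall M : R, exists N : int, forall n : int, N <= n -> M <= lam n,
      forall M : R, exists N : int, forall n : int, n <= N -> lam n <= M
    & 0 <= lam 0 /\ forall n, 0 <= lam n -> lam 0 <= lam n].

(* U t = e^{-iHt}: U is the strongly continuous one-parameter unitary group
   on ell2 whose infinitesimal generator is -iH, with domain exactly D
   (Stone's theorem). *)
Definition unitary_group_of (D : set (int -> R[i]))
    (H : (int -> R[i]) -> int -> R[i])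
    (U : R -> (int -> R[i]) -> int -> R[i]) : Prop :=
  [/\ (forall t u, ell2 u -> ell2 (U t u) /\ norm2 (U t u) = norm2 u),
      (forall t (z : R[i]) u v, ell2 u -> ell2 v ->
        forall n, U t (fun j => z * u j + v j) n = z * U t u n + U t v n),
      (forall u, ell2 u -> (forall n, U 0 u n = u n) /\
        forall s t n, U (s + t) u n = U s (U t u) n),
      (forall u, ell2 u ->
        norm2 (fun n => U h u n - u n) @[h --> (0 : R)] --> (0 : R))
    & (forall u w, ell2 u -> ell2 w ->
        (norm2 (fun n => (U h u n - u n) / h%:C - w n) @[h --> (0 : R)^']
           --> (0 : R))
        <-> (D u /\ forall n, w n = - 'i%C * H u n))].

End Defs.

(* Main.v *)
(* Write [L0 + b = n + T], where [T] is bounded by [K = ||a||_0 + ||b||].  On a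
   window [-L, L] this is a Hermitian matrix, so Weyl's inequality pairs its
   eigenvalues with the integers of the window up to an error [K], and the
   eigenvalue equation gives [|n - m| |phi_m(n)| <= 2 K] uniformly in [L].
   Taking a limit along an ultrafilter, this decay prevents any loss of mass in
   [n] or in [m], so that one gets eigenvectors [phi_m] of the full operator,
   with eigenvalues [mu_m] within [K] of [m], which are orthonormal and complete.
   Since [lam] and [mu] list the same eigenvalues with the same multiplicities,
   counting eigenvalues in intervals bounds the relabelling, which is (i).
   Bootstrapping the eigenvalue equation, one power of [|n - m|] at a time,
   gives (ii).  For (iii), [U t phi_m] and [phi_m] have the same moduli, hence
   [|(U t delta_k)(n)| <= sum_m |phi_m(k)| |phi_m(n)| = O(|n - k| ^ (-r-1))]. *)

Require Import Defs.
From HB Require Import structures.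
From mathcomp Require Import all_boot all_order all_algebra.
From mathcomp Require Import all_classical all_reals all_analysis.
From mathcomp Require Import finmap complex.
From mathcomp Require Import zify ring lra.
Import Order.TTheory GRing.Theory Num.Theory.
Import numFieldNormedType.Exports.

Set Implicit Arguments.
Unset Strict Implicit.
Unset Printing Implicit Defensive.

Local Open Scope classical_set_scope.
Local Open Scope ring_scope.
Local Open Scope complex_scope.

(** * Complex moduli and sums over the integers *)

Section Modulus.
Variable R : realType.
Implicit Types (x y z w : R[i]).

(** All spectral information comes from finite Hermitian matrices. The price is that only pointwise
    limits are available, and along these both norm and completeness could be lost. A bound of order
    [1 / (1 + |n - m|)], symmetric in [m] and [n], is what saves them: its square is summable in
    either index, uniformly in the size of the window. An ultrafilter makes all eigenvalues and all
    coordinates converge at once, without extracting subsequences. The index of [mu_m] is the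
    integer near it, whereas [lam] is counted from its first nonnegative value. The two lists are
    therefore compared fibre by fibre, and the change of origin costs the constant [4 K + 2]. The
    bootstrap uses of an eigenvector only its equation, entries of modulus at most 1 and an
    eigenvalue near [m]; hence it serves both an arbitrary basis in (ii) and the constructed one in
    (iii). Since [a 0 = 0], the norm [||a||_r] dominates all the lower ones, so a single norm
    controls every step, while the fixed [b] enters [gamma_r] through a bound [B]. In (iii) the
    phases of [U t phi_m] are never computed: their constant modulus is enough. *)

Lemma cmod_ge0 z : 0 <= cmod z.
Proof. by case: z => ? ?; exact: sqrtr_ge0. Qed.

Lemma cmodM z w : cmod (z * w) = cmod z * cmod w.
Proof. exact: ComplexField.Normc.normcM. Qed.

Lemma ler_cmodD z w : cmod (z + w) <= cmod z + cmod w.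
Proof. exact: le_normcD. Qed.

Lemma cmodN z : cmod (- z) = cmod z.
Proof. exact: normcN. Qed.

Lemma ler_cmodB z w : cmod (z - w) <= cmod z + cmod w.
Proof. by rewrite (le_trans (ler_cmodD _ _)) // cmodN. Qed.

Lemma cmod0 : cmod (0 : R[i]) = 0.
Proof. exact: ComplexField.Normc.normc0. Qed.

Lemma cmod1 : cmod (1 : R[i]) = 1.
Proof. exact: ComplexField.Normc.normc1. Qed.

Lemma cmod0_eq0 z : cmod z = 0 -> z = 0.
Proof. exact: ComplexField.Normc.eq0_normc. Qed.

Lemma cmod_real (r : R) : cmod r%:C = `|r|.
Proof. by rewrite /cmod /= expr0n addr0 sqrtr_sqr. Qed.

Lemma cmod_conj z : cmod (conjc z) = cmod z.
Proof. by case: z => a b; rewrite /cmod /= sqrrN. Qed.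

Lemma sqr_cmod z : cmod z ^+ 2 = complex.Re z ^+ 2 + complex.Im z ^+ 2.
Proof. by case: z => a b; rewrite /cmod /= sqr_sqrtr // addr_ge0 ?sqr_ge0. Qed.

Lemma mulcJ z : z * conjc z = (cmod z ^+ 2)%:C.
Proof.
rewrite sqr_cmod; case: z => a b; apply/eqP; rewrite eq_complex /=.
by apply/andP; split; apply/eqP; ring.
Qed.

Lemma ler_Re_cmod z : `|complex.Re z| <= cmod z.
Proof.
rewrite -(ler_pXn2r (n := 2)) ?nnegrE ?cmod_ge0 // sqr_cmod.
by rewrite real_normK ?num_real // lerDl sqr_ge0.
Qed.

Lemma ler_Im_cmod z : `|complex.Im z| <= cmod z.
Proof.
rewrite -(ler_pXn2r (n := 2)) ?nnegrE ?cmod_ge0 // sqr_cmod.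
by rewrite real_normK ?num_real // lerDr sqr_ge0.
Qed.

Lemma ler_cmod_ReIm z : cmod z <= `|complex.Re z| + `|complex.Im z|.
Proof.
rewrite -(ler_pXn2r (n := 2)) ?nnegrE ?cmod_ge0 ?addr_ge0 // sqr_cmod.
rewrite sqrrD !real_normK ?num_real //.
by rewrite addrAC lerDl mulrn_wge0 ?mulr_ge0.
Qed.

Lemma ReD z w : complex.Re (z + w) = complex.Re z + complex.Re w.
Proof. by case: z w => ? ? []. Qed.

Lemma ImD z w : complex.Im (z + w) = complex.Im z + complex.Im w.
Proof. by case: z w => ? ? []. Qed.

Lemma ReN z : complex.Re (- z) = - complex.Re z. Proof. by case: z. Qed.

Lemma ImN z : complex.Im (- z) = - complex.Im z. Proof. by case: z. Qed.

Lemma ReM z w : complex.Re (z * w) =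
  complex.Re z * complex.Re w - complex.Im z * complex.Im w.
Proof. by case: z w => ? ? []. Qed.

Lemma ImM z w : complex.Im (z * w) =
  complex.Re z * complex.Im w + complex.Im z * complex.Re w.
Proof. by case: z w => ? ? []. Qed.

Lemma Re_sum (I : Type) (r : seq I) (P : pred I) (F : I -> R[i]) :
  complex.Re (\sum_(i <- r | P i) F i) = \sum_(i <- r | P i) complex.Re (F i).
Proof. exact: (big_morph _ ReD erefl). Qed.

Lemma Im_sum (I : Type) (r : seq I) (P : pred I) (F : I -> R[i]) :
  complex.Im (\sum_(i <- r | P i) F i) = \sum_(i <- r | P i) complex.Im (F i).
Proof. exact: (big_morph _ ImD erefl). Qed.

Lemma ler_cmod_sum (I : Type) (r : seq I) (P : pred I) (F : I -> R[i]) :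
  cmod (\sum_(i <- r | P i) F i) <= \sum_(i <- r | P i) cmod (F i).
Proof.
elim/big_rec2: _ => [|i x z _ IH]; first by rewrite cmod0.
by rewrite (le_trans (ler_cmodD _ _)) // lerD2l.
Qed.

Lemma cmod_intr (n : int) : cmod (n%:~R : R[i]) = `|n%:~R|.
Proof. by rewrite -(rmorph_int (real_complex R)) cmod_real. Qed.

Lemma sqr_cmodD z w : cmod (z + w) ^+ 2 <= 2 * cmod z ^+ 2 + 2 * cmod w ^+ 2.
Proof.
have h : cmod (z + w) ^+ 2 <= (cmod z + cmod w) ^+ 2.
  by rewrite ler_pXn2r ?nnegrE ?addr_ge0 ?cmod_ge0 // ler_cmodD.
by have := sqr_ge0 (cmod z - cmod w); lra.
Qed.

End Modulus.

(** * Finite windows, tails and absolutely summable families *)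

Section Windows.
Variable R : realType.
Implicit Types (f g : int -> R) (F : int -> R[i]).

(** Built from [iota] so that sums reindex at once over ['I_(L.*2.+1)], the index type of the
    truncated matrices. *)
Definition window (L : nat) : seq int :=
  [seq i%:Z - L%:Z | i <- iota 0 L.*2.+1].
Arguments window L : simpl never.

Lemma mem_window L n : (n \in window L) = (`|n|%N <= L)%N.
Proof.
apply/mapP/idP => [[j]|h]; first by rewrite mem_iota => h ->; lia.
by exists (absz (n + L%:Z)%R); rewrite ?mem_iota; lia.
Qed.

Lemma window_uniq L : uniq (window L).
Proof. by rewrite map_inj_uniq ?iota_uniq // => i j; lia. Qed.

Lemma sub_window (s : seq int) : exists L, {subset s <= window L}.
Proof.
exists (\max_(n <- s) `|n|%N)%N => n ns; rewrite mem_window.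
by rewrite (big_rem n) //= leq_maxl.
Qed.

Lemma sum_window L (V : nmodType) (f : int -> V) :
  \sum_(n <- window L) f n = \sum_(i < L.*2.+1) f (i%:Z - L%:Z).
Proof. by rewrite big_map -(big_mkord xpredT (fun i => f (i%:Z - L%:Z))). Qed.

Lemma ler_sum_uniq (s t : seq int) f : (forall n, 0 <= f n) -> uniq s ->
  {subset s <= t} -> \sum_(n <- s) f n <= \sum_(n <- t) f n.
Proof.
move=> f0 us st.
have -> : \sum_(n <- s) f n = \sum_(n <- undup t | n \in s) f n.
  rewrite -[RHS]big_filter; apply/perm_big/uniq_perm => //.
    by rewrite filter_uniq ?undup_uniq.
  move=> n; rewrite mem_filter mem_undup.
  by case: (boolP (n \in s)) => //= /st ->.
rewrite big_mkcond (@le_trans _ _ (\sum_(n <- undup t) f n)) //.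
  by apply: ler_sum => n _; case: ifP.
elim: {us st s} t => //= n t IH; rewrite big_cons; case: ifP => _.
  by rewrite (le_trans IH) // lerDr.
by rewrite big_cons lerD2l.
Qed.

(** Summability of a nonnegative family through a real bound; extended reals are then met only when
    entering or leaving the definitions. *)
Definition bounded_sum f (M : R) := forall L, \sum_(n <- window L) f n <= M.

(** Allowing every finite set off the window makes the bound inherited by any sublist of a tail; the
    empty list gives [0 <= e]. *)
Definition small_tail f (L : nat) (e : R) := forall s : seq int, uniq s ->
  (forall n, n \in s -> n \notin window L) -> \sum_(n <- s) f n <= e.

Lemma bounded_sum_seq f M (s : seq int) : (forall n, 0 <= f n) ->
  bounded_sum f M -> uniq s -> \sum_(n <- s) f n <= M.
Proof.
by move=> f0 fM us; have [L /(ler_sum_uniq f0 us)/le_trans->] := sub_window s.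
Qed.

Lemma bounded_sum_inj f M (h : int -> int) : (forall n, 0 <= f n) ->
  injective h -> bounded_sum f M -> bounded_sum (f \o h) M.
Proof.
move=> f0 ih fM L; rewrite -(big_map h xpredT).
by apply: bounded_sum_seq => //; rewrite map_inj_uniq ?window_uniq.
Qed.

Lemma bounded_sum_ge0 f M : (forall n, 0 <= f n) -> bounded_sum f M -> 0 <= M.
Proof. by move=> f0 /(_ 0%N); apply: le_trans; exact: sumr_ge0. Qed.

Lemma bounded_sum_term f M n : (forall n, 0 <= f n) -> bounded_sum f M ->
  f n <= M.
Proof.
by move=> f0 fM; have := bounded_sum_seq f0 fM (s := [:: n]) isT; rewrite big_seq1.
Qed.

Lemma bounded_sum_small_tail f M (e : R) : (forall n, 0 <= f n) ->
  bounded_sum f M -> 0 < e -> exists L, small_tail f L e.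
Proof.
move=> f0 fM e0; pose A := range (fun L => \sum_(n <- window L) f n).
have hA : has_sup A.
  split; first by exists (\sum_(n <- window 0) f n), 0%N.
  by exists M => _ [L _ <-].
(* A window whose sum is within [e] of the supremum: whatever lies outside it can add at most
   [e]. *)
have [_ [L _ <-] hL] := sup_adherent e0 hA.
exists L => s us sL.
have : \sum_(n <- window L ++ s) f n <= sup A.
  apply: bounded_sum_seq => //.
    by move=> L'; apply: ub_le_sup; [case: hA|exists L'].
  rewrite cat_uniq window_uniq us andbT /=.
  by apply/hasPn => n /sL.
by rewrite big_cat /=; lra.
Qed.

Lemma small_tail_leq f L L' e : (L <= L')%N -> small_tail f L e ->
  small_tail f L' e.
Proof.
move=> LL' h s us sL; apply: h => // n /sL; rewrite !mem_window.
by apply: contra => /leq_trans->.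
Qed.

Lemma small_tail_le f g L e : (forall n, g n <= f n) -> small_tail f L e ->
  small_tail g L e.
Proof.
move=> gf h s us /(h s us); apply: le_trans.
by apply: ler_sum.
Qed.

Lemma sum_windowB (V : zmodType) (f : int -> V) L L' : (L <= L')%N ->
  \sum_(n <- window L') f n - \sum_(n <- window L) f n =
  \sum_(n <- [seq k <- window L' | k \notin window L]) f n.
Proof.
move=> LL'; rewrite [RHS]big_filter (bigID (mem (window L))) /=.
have -> : \sum_(n <- window L' | n \in window L) f n = \sum_(n <- window L) f n.
  rewrite -big_filter; apply/perm_big/uniq_perm; rewrite ?filter_uniq ?window_uniq // => n.
  by rewrite mem_filter !mem_window andb_idr // => /leq_trans->.
by rewrite addrAC subrr add0r.
Qed.

Lemma window_tail_uniq L L' : uniq [seq k <- window L' | k \notin window L].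
Proof. by rewrite filter_uniq ?window_uniq. Qed.

Lemma small_tail_window f L L' e : small_tail f L e -> (L <= L')%N ->
  \sum_(n <- window L') f n <= \sum_(n <- window L) f n + e.
Proof.
move=> h LL'; rewrite -lerBlDl sum_windowB //.
by apply: h; rewrite ?window_tail_uniq // => n; rewrite mem_filter => /andP[].
Qed.

Lemma cmod_sum_windowB F L L' e : small_tail (fun n => cmod (F n)) L e -> (L <= L')%N ->
  cmod (\sum_(n <- window L') F n - \sum_(n <- window L) F n) <= e.
Proof.
move=> h LL'; rewrite sum_windowB // (le_trans (ler_cmod_sum _ _ _)) //.
by apply: h; rewrite ?window_tail_uniq // => n; rewrite mem_filter => /andP[].
Qed.

Lemma sum_window_delta (V : nmodType) (f : int -> V) L k :
  (forall n, n != k -> f n = 0) -> k \in window L ->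
  \sum_(n <- window L) f n = f k.
Proof.
move=> fk kL; rewrite (bigD1_seq k) ?window_uniq //= big1 ?addr0 //.
Qed.

Lemma esum_fsets f (s : seq int) : uniq s ->
  (\sum_(n \in [set` s]) (f n)%:E = (\sum_(n <- s) f n)%:E)%E.
Proof.
move=> us; rewrite (fsbig_finite _ _ (finite_seq s)) -sumEFin.
apply/perm_big/uniq_perm; rewrite ?fset_uniq // => n.
by rewrite in_fset_set ?mem_setE //; exact: finite_seq.
Qed.

Lemma esum_window_le f M : (forall n, 0 <= f n) -> bounded_sum f M ->
  (\esum_(n in [set: int]) (f n)%:E <= M%:E)%E.
Proof.
move=> f0 fM; apply: ge_ereal_sup => _ /= [A [fA _] <-].
rewrite (fsbig_finite _ _ fA) sumEFin lee_fin.
by apply: (bounded_sum_seq f0 fM); rewrite fset_uniq.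
Qed.

Lemma window_esum_le f L : 
  ((\sum_(n <- window L) f n)%:E <= \esum_(n in [set: int]) (f n)%:E)%E.
Proof.
apply: esum_ge; exists [set` window L]; last by rewrite esum_fsets ?window_uniq.
by split => //; exact: finite_seq.
Qed.

Lemma esum_bounded_sum f : (forall n, 0 <= f n) ->
  (\esum_(n in [set: int]) (f n)%:E < +oo)%E ->
  bounded_sum f (fine (\esum_(n in [set: int]) (f n)%:E)).
Proof.
move=> f0 h L; rewrite -lee_fin fineK ?window_esum_le //.
by rewrite ge0_fin_numE // esum_ge0 // => n _; rewrite lee_fin.
Qed.

Lemma fine_esum_le f M : (forall n, 0 <= f n) -> bounded_sum f M ->
  fine (\esum_(n in [set: int]) (f n)%:E) <= M.
Proof.
move=> f0 fM; have h := esum_window_le f0 fM.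
rewrite -lee_fin fineK // ge0_fin_numE ?(le_lt_trans h) ?ltry //.
by rewrite esum_ge0 // => n _; rewrite lee_fin.
Qed.

Lemma bounded_sum_lt_pinfty f M : (forall n, 0 <= f n) -> bounded_sum f M ->
  (\esum_(n in [set: int]) (f n)%:E < +oo)%E.
Proof. by move=> f0 /(esum_window_le f0)/le_lt_trans->//; rewrite ltry. Qed.

Lemma fine_esum_window f M L e : (forall n, 0 <= f n) -> bounded_sum f M ->
  small_tail f L e ->
  \sum_(n <- window L) f n <= fine (\esum_(n in [set: int]) (f n)%:E)
    <= \sum_(n <- window L) f n + e.
Proof.
move=> f0 fM fL; apply/andP; split.
  by apply: esum_bounded_sum => //; exact: (bounded_sum_lt_pinfty f0 fM).
apply: fine_esum_le => // L'; case: (leqP L L') => [|/ltnW] LL'.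
  exact: small_tail_window.
apply: (@le_trans _ _ (\sum_(n <- window L) f n)).
  apply: ler_sum_uniq => //; first exact: window_uniq.
  by move=> n; rewrite !mem_window => /leq_trans->.
by rewrite lerDl; have := fL [::] isT; rewrite big_nil; apply.
Qed.

Lemma bounded_sum_le f g M : (forall n, g n <= f n) -> bounded_sum f M ->
  bounded_sum g M.
Proof. by move=> gf fM L; rewrite (le_trans _ (fM L)) // ler_sum. Qed.

Let max0_ge0 (x : R) : 0 <= Num.max x 0. Proof. by rewrite le_max lexx orbT. Qed.

Let max0_le (x : R) : Num.max x 0 <= `|x|.
Proof. by rewrite ge_max ler_norm normr_ge0. Qed.

Let max0N_le (x : R) : Num.max (- x) 0 <= `|x|.
Proof. by rewrite ge_max -normrN ler_norm normr_ge0. Qed.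

Lemma sumZ_window f g M L e : (forall n, `|f n| <= g n) -> bounded_sum g M ->
  small_tail g L e -> `|sumZ f - \sum_(n <- window L) f n| <= e.
Proof.
move=> fg gM gL.
have p n : Num.max (f n) 0 <= g n by exact: le_trans (max0_le _) (fg n).
have q n : Num.max (- f n) 0 <= g n by exact: le_trans (max0N_le _) (fg n).
have /andP[p1 p2] := fine_esum_window (fun n => max0_ge0 (f n))
  (bounded_sum_le p gM) (small_tail_le p gL).
have /andP[q1 q2] := fine_esum_window (fun n => max0_ge0 (- f n))
  (bounded_sum_le q gM) (small_tail_le q gL).
have -> : \sum_(n <- window L) f n = \sum_(n <- window L) Num.max (f n) 0
    - \sum_(n <- window L) Num.max (- f n) 0.
  rewrite -sumrB; apply: eq_bigr => n _.
  by case: (leP (f n) 0) => h; case: (leP (- f n) 0) => h'; lra.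
by rewrite /sumZ ler_norml; apply/andP; split; lra.
Qed.

Lemma sumZ_le f g M : (forall n, `|f n| <= g n) -> bounded_sum g M ->
  `|sumZ f| <= M.
Proof.
move=> fg gM.
have p n : Num.max (f n) 0 <= g n by exact: le_trans (max0_le _) (fg n).
have q n : Num.max (- f n) 0 <= g n by exact: le_trans (max0N_le _) (fg n).
have p1 := fine_esum_le (fun n => max0_ge0 (f n)) (bounded_sum_le p gM).
have q1 := fine_esum_le (fun n => max0_ge0 (- f n)) (bounded_sum_le q gM).
have p2 : 0 <= fine (\esum_(n in [set: int]) (Num.max (f n) 0)%:E).
  by rewrite fine_ge0 // esum_ge0 // => n _; rewrite lee_fin.
have q2 : 0 <= fine (\esum_(n in [set: int]) (Num.max (- f n) 0)%:E).
  by rewrite fine_ge0 // esum_ge0 // => n _; rewrite lee_fin.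
by rewrite /sumZ ler_norml; apply/andP; split; lra.
Qed.

(** The factor 2 comes from estimating real and imaginary parts separately. *)
Lemma csumZ_window F g M L e : (forall n, cmod (F n) <= g n) ->
  bounded_sum g M -> small_tail g L e ->
  cmod (csumZ F - \sum_(n <- window L) F n) <= 2 * e.
Proof.
move=> Fg gM gL; rewrite (le_trans (ler_cmod_ReIm _)) //.
rewrite ReD ImD ReN ImN Re_sum Im_sum /= mulrDl mul1r lerD //.
  by apply: (sumZ_window _ gM gL) => n; exact: le_trans (ler_Re_cmod _) (Fg n).
by apply: (sumZ_window _ gM gL) => n; exact: le_trans (ler_Im_cmod _) (Fg n).
Qed.

Lemma csumZ_le F g M : (forall n, cmod (F n) <= g n) -> bounded_sum g M ->
  cmod (csumZ F) <= 2 * M.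
Proof.
move=> Fg gM; rewrite (le_trans (ler_cmod_ReIm _)) //= mulrDl mul1r lerD //.
  by apply: (sumZ_le _ gM) => n; exact: le_trans (ler_Re_cmod _) (Fg n).
by apply: (sumZ_le _ gM) => n; exact: le_trans (ler_Im_cmod _) (Fg n).
Qed.

(** The way to compute a [csumZ]: it suffices that the candidate be approximated by window sums as
    well as the tails of a majorant allow. *)
Lemma csumZ_eq F g M z : (forall n, cmod (F n) <= g n) -> bounded_sum g M ->
  (forall L e, small_tail g L e -> cmod (z - \sum_(n <- window L) F n) <= e) ->
  csumZ F = z.
Proof.
move=> Fg gM h; apply/eqP; rewrite -subr_eq0; apply/eqP/cmod0_eq0.
have g0 n : 0 <= g n by exact: le_trans (cmod_ge0 _) (Fg n).
apply/eqP; rewrite eq_le cmod_ge0 andbT; apply/ler_addgt0Pl => e e0.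
(* [csumZ_window] costs [2 * (e / 3)] and the hypothesis on [z] costs [e / 3]. *)
have [|L gL] := bounded_sum_small_tail g0 gM (e := e / 3); first by lra.
have h1 := csumZ_window Fg gM gL; have h2 := h _ _ gL.
have := ler_cmodB (csumZ F - \sum_(n <- window L) F n)
  (z - \sum_(n <- window L) F n).
rewrite opprB addrA subrK addr0 => /le_trans -> //; lra.
Qed.

End Windows.

(** * Weyl's inequality for Hermitian matrices *)

Section WeylInequality.
Variable R : realType.
Local Notation C := R[i].

Lemma hermitian_diagonalization (p : nat) (H : 'M[C]_p) :
  (forall i j, H j i = conjc (H i j)) ->
  exists (mu : 'I_p -> R) (psi : 'M[C]_p),
    [/\ forall m m', \sum_n psi m n * conjc (psi m' n) = (m == m')%:R,
        forall n n', \sum_m psi m n * conjc (psi m n') = (n == n')%:R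
      & forall m n, \sum_k H n k * psi m k = (mu m)%:C * psi m n].
Proof.
move=> Hh.
have Hherm : H \is hermsymmx.
  apply/is_hermitianmxP; rewrite expr0 scale1r; apply/matrixP => i j.
  by rewrite !mxE Hh.
have /orthomx_spectralP HE := hermitian_normalmx Hherm.
have /mxOverP Dreal := hermitian_spectral_diag_real Hherm.
have Pu := spectral_unitarymx H.
set P := spectralmx H in HE Pu *; set D := spectral_diag H in HE Dreal *.
have PP : P *m map_mx conjc P^T = 1%:M by apply/unitarymxP.
have PP' : map_mx conjc P^T *m P = 1%:M by apply: mulmx1C.
have PH : P *m H = diag_mx D *m P.
  by rewrite [in LHS]HE !mulmxA mulmxV ?mul1mx // unitarymx_unit.
(* The rows of [P] are left eigenvectors; since [H] is Hermitian, conjugating their entries turns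
   them into right eigenvectors. *)
exists (fun i => complex.Re (D 0 i)), (map_mx conjc P); split.
- move=> m m'; have /matrixP/(_ m' m) := PP; rewrite !mxE (eq_sym m) => <-.
  by apply: eq_bigr => n _; rewrite !mxE conjcK mulrC.
- move=> n n'; have /matrixP/(_ n n') := PP'; rewrite !mxE => <-.
  by apply: eq_bigr => m _; rewrite !mxE conjcK.
- move=> m n; have /matrixP/(_ m n)/(congr1 conjc) := PH.
  rewrite mul_diag_mx !mxE rmorph_sum rmorphM /= => h.
  rewrite -[(_)%:C]conjc_real RRe_real ?Dreal // -h.
  by apply: eq_bigr => k _; rewrite !mxE rmorphM /= -Hh mulrC.
Qed.

Lemma sorting_perm (p : nat) (f : 'I_p -> R) :
  exists2 s : 'I_p -> 'I_p, bijective s &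
    forall i j : 'I_p, (i <= j)%N -> f (s i) <= f (s j).
Proof.
case: p f => [|p] f; first by exists id => [|[]//]; exists id.
pose r := relpre f <=%R; pose t := sort r (enum 'I_p.+1).
have st : size t = p.+1 by rewrite size_sort size_enum_ord.
have ut : uniq t by rewrite sort_uniq enum_uniq.
have tot : total r by move=> i j; exact: le_total.
have tr : transitive r by move=> i j k; exact: le_trans.
exists (fun i : 'I_p.+1 => nth ord0 t i).
  apply: injF_bij => i j /eqP; rewrite nth_uniq ?st ?ltn_ord //.
  by move=> /eqP/val_inj.
move=> i j ij; apply: (sorted_leq_nth tr _ ord0 (sort_sorted tot _)) => //.
- by move=> x; exact: lexx.
- by rewrite inE st ltn_ord.
- by rewrite inE st ltn_ord.
Qed.

(* Prescribing [c j = 0] on [Q] and [(c psi) n = 0] off [Q] except at [i]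
   gives one condition fewer than unknowns. *)
Lemma common_vector (p : nat) (psi : 'M[C]_p) (Q : pred 'I_p) (i : 'I_p) :
  ~~ Q i -> exists2 c : 'rV[C]_p, c != 0 & (forall j, Q j -> c 0 j = 0) /\
    (forall n, n != i -> ~~ Q n -> \sum_j c 0 j * psi j n = 0).
Proof.
move=> Qi.
pose T := \matrix_(j, n) (if n == i then 0 else
                          if Q n then (j == n)%:R else psi j n) : 'M[C]_p.
have /eqP/det0P[c c0 cT] : \det T = 0.
  rewrite (expand_det_col T i) big1 // => j _; by rewrite mxE eqxx mul0r.
exists c => //; split=> [j Qj|n ni Qn].
  have ji : j != i by apply: contraNneq Qi => <-.
  have /rowP/(_ j) := cT; rewrite !mxE => h; rewrite -[RHS]h.
  rewrite (bigD1 j) //= big1 ?addr0 => [|k kj].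
    by rewrite !mxE (negbTE ji) Qj eqxx mulr1.
  by rewrite !mxE (negbTE ji) Qj (negbTE kj) mulr0.
have /rowP/(_ n) := cT; rewrite !mxE => h; rewrite -[RHS]h.
by apply: eq_bigr => j _; rewrite !mxE (negbTE ni) (negbTE Qn).
Qed.

(** Parseval for finite combinations. The list of vectors and the list of coordinates are
    independent, so that it also applies to part of an eigenbasis. *)
Lemma sum_orthonormal (I : eqType) (J : Type) (s : seq I) (t : seq J)
    (psi : I -> J -> C) (c d : I -> C) : uniq s ->
  (forall m m', m \in s -> m' \in s ->
    \sum_(n <- t) psi m n * conjc (psi m' n) = (m == m')%:R) ->
  \sum_(n <- t) (\sum_(j <- s) c j * psi j n) *
    conjc (\sum_(j <- s) d j * psi j n) = \sum_(j <- s) c j * conjc (d j).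
Proof.
move=> us psi1.
transitivity (\sum_(n <- t) \sum_(j <- s) \sum_(l <- s) c j * conjc (d l) *
    (psi j n * conjc (psi l n))).
  apply: eq_bigr => n _; rewrite mulr_suml; apply: eq_bigr => j _.
  rewrite rmorph_sum mulr_sumr; apply: eq_bigr => l _.
  by rewrite rmorphM; ring.
rewrite exchange_big; apply: eq_big_seq => j js; rewrite exchange_big /=.
rewrite (bigD1_seq j) //= -mulr_sumr psi1 // eqxx mulr1 -big_filter big1_seq ?addr0 // => l.
rewrite mem_filter => /and3P[_ lj ls].
by rewrite -mulr_sumr psi1 // eq_sym (negbTE lj) mulr0.
Qed.

(** Each product [|u_k| |u_n|] is at most half the sum of the squares; one half is summed by rows,
    the other by columns. *)
Lemma quadratic_form_le (I : finType) (B : I -> I -> C) (K : R) (u : I -> C) :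
  (forall i, \sum_j cmod (B i j) <= K) ->
  (forall j, \sum_i cmod (B i j) <= K) ->
  cmod (\sum_n (\sum_k B n k * u k) * conjc (u n)) <= K * \sum_n cmod (u n) ^+ 2.
Proof.
move=> BK BK'; rewrite (le_trans (ler_cmod_sum _ _ _)) //.
apply: (@le_trans _ _ (\sum_n \sum_k
   (cmod (B n k) * cmod (u k) ^+ 2 / 2 + cmod (B n k) * cmod (u n) ^+ 2 / 2))).
  apply: ler_sum => n _; rewrite cmodM cmod_conj.
  apply: (@le_trans _ _ ((\sum_k cmod (B n k * u k)) * cmod (u n))).
    by rewrite ler_wpM2r ?cmod_ge0 // ler_cmod_sum.
  rewrite mulr_suml; apply: ler_sum => k _; rewrite cmodM.
  have := sqr_ge0 (cmod (u k) - cmod (u n)).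
  have := cmod_ge0 (B n k); set b := cmod (B n k) => b0 h.
  have : 0 <= b * (cmod (u k) - cmod (u n)) ^+ 2 by rewrite mulr_ge0.
  lra.
have h1 : \sum_n \sum_k cmod (B n k) * cmod (u n) ^+ 2 <=
    K * \sum_n cmod (u n) ^+ 2.
  rewrite mulr_sumr; apply: ler_sum => n _; rewrite -mulr_suml.
  by rewrite ler_wpM2r ?sqr_ge0.
have h2 : \sum_n \sum_k cmod (B n k) * cmod (u k) ^+ 2 <=
    K * \sum_n cmod (u n) ^+ 2.
  rewrite exchange_big mulr_sumr; apply: ler_sum => n _; rewrite -mulr_suml.
  by rewrite ler_wpM2r ?sqr_ge0.
apply: (@le_trans _ _ ((\sum_n \sum_k cmod (B n k) * cmod (u k) ^+ 2) / 2 +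
  (\sum_n \sum_k cmod (B n k) * cmod (u n) ^+ 2) / 2)); last by lra.
rewrite !mulr_suml -big_split /=; apply: ler_sum => n _.
by rewrite !mulr_suml -big_split.
Qed.

(** Weighted Cauchy-Schwarz on each row, obtained by symmetrizing a double sum, uses the row sums;
    exchanging the summations then uses the column sums. *)
Lemma schur_test (I : finType) (B : I -> I -> C) (K : R) (u : I -> C) :
  (forall i, \sum_j cmod (B i j) <= K) ->
  (forall j, \sum_i cmod (B i j) <= K) ->
  \sum_n cmod (\sum_k B n k * u k) ^+ 2 <= K ^+ 2 * \sum_n cmod (u n) ^+ 2.
Proof.
move=> BK BK'.
have row n : cmod (\sum_k B n k * u k) ^+ 2 <=
    K * \sum_k cmod (B n k) * cmod (u k) ^+ 2.
  set S := \sum_k _ * _ ^+ 2.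
  have S0 : 0 <= S by rewrite sumr_ge0 // => k _; rewrite mulr_ge0 ?cmod_ge0 ?sqr_ge0.
  apply: (@le_trans _ _ ((\sum_k cmod (B n k) * cmod (u k)) ^+ 2)).
    rewrite ler_pXn2r ?nnegrE ?cmod_ge0 // ?sumr_ge0 // => [|k _]; last first.
      by rewrite mulr_ge0 ?cmod_ge0.
    rewrite (le_trans (ler_cmod_sum _ _ _)) //.
    by apply: ler_sum => k _; rewrite cmodM.
  apply: (@le_trans _ _ ((\sum_k cmod (B n k)) * S)); last by rewrite ler_wpM2r.
  have : \sum_k \sum_l cmod (B n k) * cmod (B n l) *
      (cmod (u k) ^+ 2 / 2 + cmod (u l) ^+ 2 / 2) = (\sum_k cmod (B n k)) * S.
    under eq_bigr => k _ do under eq_bigr => l _ do rewrite mulrDr.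
    under eq_bigr => k _ do rewrite big_split /=.
    rewrite big_split /= [X in X + _]exchange_big /= -big_split /=.
    rewrite mulr_suml; apply: eq_bigr => k _; rewrite mulr_sumr -big_split /=.
    by apply: eq_bigr => l _; lra.
  move=> <-; rewrite expr2 mulr_suml; apply: ler_sum => k _.
  rewrite mulr_sumr; apply: ler_sum => l _.
  have : 0 <= cmod (B n k) * cmod (B n l) * (cmod (u k) - cmod (u l)) ^+ 2.
    by rewrite mulr_ge0 ?sqr_ge0 // mulr_ge0 ?cmod_ge0.
  lra.
have K0 : forall i : I, 0 <= K.
  by move=> i; apply: le_trans (BK i); apply: sumr_ge0 => j _; exact: cmod_ge0.
apply: (@le_trans _ _ (\sum_n K * \sum_k cmod (B n k) * cmod (u k) ^+ 2)).
  exact: ler_sum.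
rewrite -mulr_sumr exchange_big expr2 -mulrA !mulr_sumr.
apply: ler_sum => k _; rewrite ler_wpM2l ?(K0 k) //.
by rewrite -mulr_suml ler_wpM2r ?sqr_ge0.
Qed.

(** Min-max argument: a nonzero vector spanned by the eigenvectors of index at most [i] and
    supported on the coordinates from [i] on has energy at most [mu i] and at least [d i - K] times
    its squared norm. The mirror choice gives the other inequality. *)
Lemma weyl_eigenbasis (p : nat) (B : 'M[C]_p) (d : 'I_p -> R) (K : R) :
  (forall i j, B j i = conjc (B i j)) ->
  (forall i, \sum_j cmod (B i j) <= K) ->
  (forall i j : 'I_p, (i <= j)%N -> d i <= d j) ->
  exists (mu : 'I_p -> R) (psi : 'M[C]_p),
    [/\ forall m, `|mu m - d m| <= K,
        forall m m', \sum_n psi m n * conjc (psi m' n) = (m == m')%:R,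
        forall n n', \sum_m psi m n * conjc (psi m n') = (n == n')%:R
      & forall m n, \sum_k B n k * psi m k + (d n)%:C * psi m n =
                    (mu m)%:C * psi m n].
Proof.
move=> Bh BK dmono.
have BK' j : \sum_i cmod (B i j) <= K.
  rewrite (le_trans _ (BK j)) //; apply: ler_sum => i _.
  by rewrite Bh cmod_conj.
pose H := B + diag_mx (\row_i (d i)%:C).
have HE n k : H n k = B n k + (d n)%:C * (n == k)%:R.
  by rewrite !mxE; case: (n == k); rewrite ?mulr1 ?mulr0 ?mulr1n ?mulr0n.
have Hh i j : H j i = conjc (H i j).
  rewrite !HE rmorphD rmorphM /= conjc_nat oppr0 Bh eq_sym.
  by case: eqP => [->|] //=; rewrite !mulr0.
have [mu0 [psi0 [on0 co0 eig0]]] := hermitian_diagonalization Hh.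
have [s [s' ss' s's] smono] := sorting_perm mu0.
have sinj := can_inj ss'.
pose psi : 'M[C]_p := \matrix_(i, j) psi0 (s i) j.
have on m m' : \sum_n psi m n * conjc (psi m' n) = (m == m')%:R.
  by under eq_bigr do rewrite !mxE; rewrite on0 (inj_eq sinj).
have Hu (u : 'I_p -> C) n : \sum_k H n k * u k =
    \sum_k B n k * u k + (d n)%:C * u n.
  under eq_bigr => k _ do rewrite HE mulrDl.
  rewrite big_split /= [X in _ + X](bigD1 n) //= eqxx mulr1.
  rewrite [X in _ + (_ + X)]big1 ?addr0 // => k kn.
  by rewrite eq_sym (negbTE kn) mulr0 mul0r.
have eig m n : \sum_k B n k * psi m k + (d n)%:C * psi m n =
    (mu0 (s m))%:C * psi m n.
  by rewrite -(Hu (psi m)) [psi m n]mxE -eig0; apply: eq_bigr => k _; rewrite [psi m k]mxE.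
exists (mu0 \o s), psi; split => //; last first.
  move=> n n'; rewrite -co0 [RHS](reindex_inj sinj) /=.
  by apply: eq_bigr => m _; rewrite !mxE.
move=> i /=.
(* The energy of [u] is evaluated twice: by Parseval in the eigenbasis, and in the coordinates as
   the diagonal part plus a form bounded by [K]. *)
have key (Q : pred 'I_p) : ~~ Q i -> exists c u : 'I_p -> C,
    [/\ 0 < \sum_j cmod (c j) ^+ 2, forall j, Q j -> c j = 0,
        forall n, n != i -> ~~ Q n -> u n = 0,
        \sum_n cmod (u n) ^+ 2 = \sum_j cmod (c j) ^+ 2 &
      `|\sum_j mu0 (s j) * cmod (c j) ^+ 2 - \sum_n d n * cmod (u n) ^+ 2|
        <= K * \sum_j cmod (c j) ^+ 2].
  move=> /(common_vector psi)[c c0 [cQ uQ]].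
  pose u n := \sum_j c 0 j * psi j n; exists (fun j => c 0 j), u.
  have uc : \sum_n cmod (u n) ^+ 2 = \sum_j cmod (c 0 j) ^+ 2.
    apply: (@complexI R); rewrite !rmorph_sum /=.
    under eq_bigr do rewrite -mulcJ.
    rewrite (sum_orthonormal _ _ (index_enum_uniq _) (fun m m' _ _ => on m m')).
    by apply: eq_bigr => j _; rewrite mulcJ.
  split => //.
    rewrite lt_neqAle sumr_ge0 ?andbT => [|j _]; last exact: sqr_ge0.
    apply: contraNneq c0 => h; apply/eqP/rowP => j; rewrite mxE.
    apply: cmod0_eq0; apply/eqP; rewrite -sqrf_eq0.
    by have /eqP := esym h; rewrite psumr_eq0 => [/allP/(_ j (mem_index_enum _))|k _];
       last exact: sqr_ge0.
  have E : \sum_n (\sum_k H n k * u k) * conjc (u n) =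
      (\sum_j mu0 (s j) * cmod (c 0 j) ^+ 2)%:C.
    rewrite rmorph_sum /=.
    transitivity (\sum_n (\sum_j (c 0 j * (mu0 (s j))%:C) * psi j n) * conjc (u n)).
      apply: eq_bigr => n _; congr (_ * _).
      under eq_bigr => k _ do rewrite mulr_sumr.
      rewrite exchange_big; apply: eq_bigr => j _ /=.
      rewrite -mulrA -eig -(Hu (psi j)) mulr_sumr; apply: eq_bigr => k _; ring.
    rewrite (sum_orthonormal _ _ (index_enum_uniq _) (fun m m' _ _ => on m m')).
    apply: eq_bigr => j _.
    by rewrite rmorphM /= -mulcJ; ring.
  have := quadratic_form_le u BK BK'; rewrite uc.
  suff -> : \sum_n (\sum_k B n k * u k) * conjc (u n) =
    (\sum_j mu0 (s j) * cmod (c 0 j) ^+ 2 - \sum_n d n * cmod (u n) ^+ 2)%:C.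
    by rewrite cmod_real.
  rewrite rmorphB /= -E rmorph_sum /= -sumrB; apply: eq_bigr => n _.
  by rewrite Hu mulrDl rmorphM /= -mulcJ; ring.
have le_sum (v w : 'I_p -> R) (x : 'I_p -> C) :
    (forall j, x j != 0 -> v j <= w j) ->
    \sum_j v j * cmod (x j) ^+ 2 <= \sum_j w j * cmod (x j) ^+ 2.
  move=> vw; apply: ler_sum => j _; have [->|xj] := eqVneq (x j) 0.
    by rewrite cmod0 expr0n /= !mulr0.
  by rewrite ler_wpM2r ?sqr_ge0 ?vw.
rewrite ler_norml; apply/andP; split.
  (* No eigenvectors above [i], no coordinates below [i]: this bounds [mu i] from below. *)
  have [|c [u [c0 cQ uQ uc]]] := key (fun j : 'I_p => (i < j)%N); first by rewrite /= ltnn.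
  have h1 : \sum_j mu0 (s j) * cmod (c j) ^+ 2 <= \sum_j mu0 (s i) * cmod (c j) ^+ 2.
    apply: le_sum => j; case: (leqP j i) => [/smono//|ij].
    by rewrite cQ ?eqxx.
  have h2 : \sum_n d i * cmod (u n) ^+ 2 <= \sum_n d n * cmod (u n) ^+ 2.
    apply: le_sum => n; case: (ltnP n i) => [ni|/dmono//].
    by rewrite uQ ?eqxx // -?leqNgt 1?ltnW // -val_eqE /= ltn_eqF.
  rewrite -!mulr_sumr uc in h1 h2; move: c0 h1 h2.
  set c2 := \sum_j cmod (c j) ^+ 2 => c0 h1 h2; rewrite ler_norml => /andP[h3 h4].
  by rewrite -(ler_pM2r c0); lra.
(* No eigenvectors below [i], no coordinates above [i]: this bounds [mu i] from above. *)
have [|c [u [c0 cQ uQ uc]]] := key (fun j : 'I_p => (j < i)%N); first by rewrite /= ltnn.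
have h1 : \sum_j mu0 (s i) * cmod (c j) ^+ 2 <= \sum_j mu0 (s j) * cmod (c j) ^+ 2.
  apply: le_sum => j; case: (leqP i j) => [/smono//|ij].
  by rewrite cQ ?eqxx.
have h2 : \sum_n d n * cmod (u n) ^+ 2 <= \sum_n d i * cmod (u n) ^+ 2.
  apply: le_sum => n; case: (ltnP i n) => [ni|/dmono//].
  by rewrite uQ ?eqxx // -?leqNgt 1?ltnW // -val_eqE /= gtn_eqF.
rewrite -!mulr_sumr uc in h1 h2; move: c0 h1 h2.
set c2 := \sum_j cmod (c j) ^+ 2 => c0 h1 h2; rewrite ler_norml => /andP[h3 h4].
by rewrite -(ler_pM2r c0); lra.
Qed.

End WeylInequality.

(** * Truncation to a window *)

Section InverseSquares.
Variable R : realType.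

(** The shift by 1 keeps the weight finite at 0, so diagonal and off-diagonal entries are estimated
    together. *)
Definition invsq (n : int) : R := (1 + `|n%:~R|) ^- 2.

Lemma invsq_ge0 n : 0 <= invsq n.
Proof. by rewrite invr_ge0 exprn_ge0 // addr_ge0. Qed.

Lemma sum_windowS (V : nmodType) (f : int -> V) L :
  \sum_(n <- window L.+1) f n =
  \sum_(n <- window L) f n + (f L.+1%:Z + f (- L.+1%:Z)).
Proof.
have -> : \sum_(n <- window L) f n + (f L.+1%:Z + f (- L.+1%:Z)) =
   \sum_(n <- window L ++ [:: L.+1%:Z; - L.+1%:Z]) f n.
  by rewrite big_cat /= !big_cons big_nil addr0.
apply/perm_big/uniq_perm; first exact: window_uniq.
  rewrite cat_uniq window_uniq /= !mem_window ?inE; lia.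
by move=> n; rewrite mem_cat !mem_window !inE; lia.
Qed.

Lemma sum_window0 (V : nmodType) (f : int -> V) :
  \sum_(n <- window 0) f n = f 0.
Proof. by rewrite sum_window big_ord1. Qed.

Lemma bounded_sum_invsq : bounded_sum invsq 4.
Proof.
(* Strengthened for the induction: the two new terms [2 / (L + 2)^2] are at most the telescoping
   difference [2 / (L + 1) - 2 / (L + 2)]. *)
move=> L; suff: \sum_(n <- window L) invsq n <= 4 - 2 / L.+1%:R.
  by move=> /le_trans-> //; rewrite gerBl divr_ge0.
elim: L => [|L IH]; first by rewrite sum_window0 /invsq normr0 addr0 expr1n invr1; lra.
rewrite sum_windowS /invsq mulrNz normrN; move: IH; rewrite -/invsq => IH.
apply: le_trans (lerD IH (lexx _)) _.
have -> : 1 + `|(L.+1)%:~R| = L.+2%:R :> R by rewrite ger0_norm ?ler0z // -natr1 addrC.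
have h : 0 < L.+1%:R :> R by rewrite ltr0n.
have -> : L.+2%:R = L.+1%:R + 1 :> R by rewrite -natr1.
move: (L.+1%:R) h => y y0.
have -> : 4 - 2 / (y + 1) = 4 - 2 / y + 2 / (y * (y + 1)) :> R.
  by field; rewrite ?gt_eqF //; lra.
have : (y + 1) ^- 2 <= (y * (y + 1))^-1.
  by rewrite lef_pV2 ?posrE ?exprn_gt0 ?mulr_gt0 ?expr2 ?ler_pM2r //; lra.
lra.
Qed.

(** Arithmetic-geometric mean: a product of two first-order decays with different centres gets a
    majorant whose summability does not depend on the centres. *)
Lemma invsq_mul (x y X Y : R) (m n : int) : 0 <= X -> 0 <= Y ->
  (1 + `|m%:~R|) * x <= X -> (1 + `|n%:~R|) * y <= Y -> 0 <= x -> 0 <= y ->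
  x * y <= X * Y / 2 * (invsq m + invsq n).
Proof.
rewrite /invsq; set p := 1 + _; set q := 1 + _ => X0 Y0 hx hy x0 y0.
have p0 : 0 < p by rewrite ltr_pwDl.
have q0 : 0 < q by rewrite ltr_pwDl.
have hx' : x <= X / p by rewrite ler_pdivlMr // mulrC.
have hy' : y <= Y / q by rewrite ler_pdivlMr // mulrC.
apply: le_trans (ler_pM x0 y0 hx' hy') _.
have -> : X / p * (Y / q) = X * Y / 2 * (2 * (p^-1 * q^-1)).
  by field; rewrite ?gt_eqF.
rewrite ler_wpM2l ?divr_ge0 ?mulr_ge0 // -!exprVn.
by have := sqr_ge0 (p^-1 - q^-1); rewrite sqrrB; lra.
Qed.

Lemma sqr_le_invsq (x X : R) (n : int) : 0 <= x -> 0 <= X ->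
  (1 + `|n%:~R|) * x <= X -> x ^+ 2 <= X ^+ 2 * invsq n.
Proof.
move=> x0 X0 hx; rewrite -expr_div_n.
rewrite ler_pXn2r ?nnegrE //; last by rewrite divr_ge0 // addr_ge0.
by rewrite ler_pdivlMr ?ltr_pwDl // mulrC.
Qed.

Lemma bounded_sumD (f g : int -> R) M N : bounded_sum f M -> bounded_sum g N ->
  bounded_sum (fun n => f n + g n) (M + N).
Proof. by move=> fM gN L; rewrite big_split lerD. Qed.

Lemma bounded_sumZ (f : int -> R) c M : 0 <= c -> bounded_sum f M ->
  bounded_sum (fun n => c * f n) (c * M).
Proof. by move=> c0 fM L; rewrite -mulr_sumr ler_wpM2l. Qed.

Lemma bounded_sum_invsqB k : bounded_sum (fun n => invsq (n - k)) 4.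
Proof.
apply: (@bounded_sum_inj _ invsq 4 (fun n => n - k) invsq_ge0).
  by move=> m n /addIr.
exact: bounded_sum_invsq.
Qed.

Lemma bounded_sum_invsqBr k : bounded_sum (fun n => invsq (k - n)) 4.
Proof.
apply: (@bounded_sum_inj _ invsq 4 (fun n => k - n) invsq_ge0).
  by move=> m n /addrI/oppr_inj.
exact: bounded_sum_invsq.
Qed.

End InverseSquares.

(** * Eigenvectors of the truncated operator *)

Section Truncation.
Variables (R : realType) (a : int -> R[i]) (b : int -> R) (x B : R).
Hypothesis aH : forall m : int, a m = conjc (a (- m)).
Hypothesis ax : bounded_sum (fun n => cmod (a n)) x.
Hypothesis bB : forall n : int, `|b n| <= B.

Let K := x + B.

(* The matrix of [L0 + b] without its unbounded diagonal [n]. *)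
Definition kernel (n k : int) : R[i] := a (n - k) + (b n)%:C * (n == k)%:R.

Let x_ge0 : 0 <= x.
Proof. by apply: bounded_sum_ge0 ax => n; exact: cmod_ge0. Qed.

Let B_ge0 : 0 <= B. Proof. exact: le_trans (bB 0). Qed.

Let K_ge0 : 0 <= K. Proof. exact: addr_ge0. Qed.

Lemma kernel_conj n k : kernel k n = conjc (kernel n k).
Proof.
rewrite /kernel rmorphD rmorphM /= conjc_nat oppr0 [a (k - n)]aH opprB eq_sym.
by case: eqP => [->|_] //; rewrite !mulr0.
Qed.

Lemma cmod_kernel_row n (s : seq int) : uniq s ->
  \sum_(k <- s) cmod (kernel n k) <= K.
Proof.
move=> us; apply: (@le_trans _ _ (\sum_(k <- s) (cmod (a (n - k)) +
    (if k == n then B else 0)))).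
  apply: ler_sum => k _; rewrite (le_trans (ler_cmodD _ _)) // lerD2l eq_sym.
  by case: eqP => _; [rewrite mulr1 cmod_real bB|rewrite mulr0 cmod0].
rewrite big_split lerD //.
  rewrite -(big_map (fun k => n - k) xpredT (fun k => cmod (a k))).
  apply: (bounded_sum_seq _ ax) => [k|]; first exact: cmod_ge0.
  by rewrite map_inj_uniq // => i j /addrI/oppr_inj.
rewrite -big_mkcond /=; have [ns|ns] := boolP (n \in s); last first.
  rewrite big1_seq // => k /andP[/eqP -> ks]; by rewrite ks in ns.
rewrite -big_filter (_ : [seq i <- s | i == n] = [:: n]) ?big_seq1 //.
by apply: filter_pred1_uniq.
Qed.

Let dom (L : nat) := 'I_L.*2.+1.
Let pos L (i : dom L) : int := i%:Z - L%:Z.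
(** Meaningful on the window only; outside it [absz] and [inord] return arbitrary indices, so
    eigenvectors built from [idx] must be cut off by a membership test. *)
Let idx L (n : int) : dom L := inord (absz (n + L%:Z)%R).

Let posK L (i : dom L) : idx L (pos i) = i.
Proof.
rewrite /idx /pos subrK; apply: val_inj; rewrite /= inordK //=.
Qed.

Let idxK L n : n \in window L -> pos (idx L n) = n.
Proof. by rewrite mem_window /pos /idx => h; rewrite /= inordK; lia. Qed.

Lemma truncated_eigenbasis L : exists (mu : int -> R) (phi : int -> int -> R[i]),
  [/\ forall m, `|mu m - m%:~R| <= K,
      forall m m', m \in window L -> m' \in window L ->
        \sum_(n <- window L) phi m n * conjc (phi m' n) = (m == m')%:R,
      forall n n', n \in window L -> n' \in window L ->
        \sum_(m <- window L) phi m n * conjc (phi m n') = (n == n')%:R,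
      forall m n, m \in window L -> n \in window L ->
        \sum_(k <- window L) kernel n k * phi m k + n%:~R * phi m n =
        (mu m)%:C * phi m n
    & forall m n, (m \notin window L) || (n \notin window L) -> phi m n = 0].
Proof.
pose T : 'M[R[i]]_L.*2.+1 := \matrix_(i, j) kernel (pos i) (pos j).
have TH i j : T j i = conjc (T i j) by rewrite !mxE kernel_conj.
have TK i : \sum_j cmod (T i j) <= K.
  under eq_bigr do rewrite mxE.
  rewrite -(sum_window L (fun k => cmod (kernel (pos i) k))).
  exact: (cmod_kernel_row _ (window_uniq L)).
have [|mu [psi [muK on co eig]]] :=
  weyl_eigenbasis (d := fun i : dom L => (pos i)%:~R) TH TK.
  by move=> i j ij; rewrite ler_int lerD2r lez_nat.
pose phi m n : R[i] := if (m \in window L) && (n \in window L)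
  then psi (idx L m) (idx L n) else 0.
have pos_win (i : dom L) : pos i \in window L.
  by rewrite mem_window /pos; have := ltn_ord i; lia.
have phiE m (i : dom L) : m \in window L -> phi m (pos i) = psi (idx L m) i.
  by move=> mL; rewrite /phi mL pos_win posK.
have phiE' n (i : dom L) : n \in window L -> phi (pos i) n = psi i (idx L n).
  by move=> nL; rewrite /phi nL pos_win posK.
have idxE m m' : m \in window L -> m' \in window L ->
    (idx L m == idx L m') = (m == m').
  by move=> mL mL'; rewrite -(inj_eq (can_inj (@posK L))) !idxK.
(* The value [m] outside the window keeps the eigenvalue bound valid for every integer. *)
exists (fun m => if m \in window L then mu (idx L m) else m%:~R), phi; split.
- move=> m; case: ifP => [mL|_]; first by rewrite -{2}(idxK mL).
  by rewrite subrr normr0.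
- move=> m m' mL mL'; rewrite sum_window -idxE // -on.
  by apply: eq_bigr => i _; rewrite -/(pos i) !phiE.
- move=> n n' nL nL'; rewrite sum_window -idxE // -co.
  by apply: eq_bigr => i _; rewrite -/(pos i) !phiE'.
- move=> m n mL nL; rewrite mL sum_window.
  have := eig (idx L m) (idx L n).
  rewrite -(phiE' n (idx L m)) // !idxK // => <-; congr (_ + _).
    by apply: eq_bigr => i _; rewrite -/(pos i) phiE // mxE idxK.
  by rewrite -(rmorph_int (real_complex R)).
- by move=> m n; rewrite /phi -negb_and => /negbTE ->.
Qed.

Lemma orthonormal_le1 L (phi : int -> int -> R[i]) m n :
  (m \in window L -> \sum_(n <- window L) phi m n * conjc (phi m n) = 1) ->
  ((m \notin window L) || (n \notin window L) -> phi m n = 0) ->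
  cmod (phi m n) <= 1.
Proof.
move=> on v; have [/andP[mL nL]|/nandP/orP/v->] :=
    boolP ((m \in window L) && (n \in window L)); last by rewrite cmod0.
have : \sum_(n <- window L) cmod (phi m n) ^+ 2 = 1.
  apply: (@complexI R); rewrite rmorph_sum rmorph1 -on //.
  by apply: eq_bigr => k _; rewrite mulcJ.
rewrite (bigD1_seq n) ?window_uniq //= => h.
have : 0 <= \sum_(i <- window L | i != n) cmod (phi m i) ^+ 2.
  by apply: sumr_ge0 => k _; exact: sqr_ge0.
have := cmod_ge0 (phi m n); nra.
Qed.

(** In row [n] of the equation, entries of modulus at most 1 leave the row sum [K] of the kernel;
    the second [K] is the displacement of [mu m] from [m], and the summand 1 pays for the shift in
    the weight. *)
Lemma truncated_decay L (phi : int -> int -> R[i]) (mu : int -> R) m n :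
  (forall m n, cmod (phi m n) <= 1) ->
  (forall m n, (m \notin window L) || (n \notin window L) -> phi m n = 0) ->
  `|mu m - m%:~R| <= K ->
  (m \in window L -> n \in window L ->
        \sum_(k <- window L) kernel n k * phi m k + n%:~R * phi m n =
        (mu m)%:C * phi m n) ->
  (1 + `|(n - m)%:~R|) * cmod (phi m n) <= 1 + 2 * K.
Proof.
move=> phi1 v muK eig.
have [/andP[mL nL]|/nandP/orP/v->] :=
    boolP ((m \in window L) && (n \in window L)); last first.
  by rewrite cmod0 mulr0 addr_ge0 // mulr_ge0.
rewrite mulrDl mul1r lerD //.
have {}eig : (m%:~R - n%:~R) * phi m n =
    \sum_(k <- window L) kernel n k * phi m k - (mu m - m%:~R)%:C * phi m n.
  have := eig mL nL; rewrite rmorphB /= rmorph_int => h.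
  rewrite mulrBl (_ : \sum_(k <- _) _ = (mu m)%:C * phi m n - n%:~R * phi m n); first ring.
  by rewrite -h addrK.
rewrite -cmod_intr -cmodM intrB -opprB mulNr cmodN eig mulrDl mul1r.
rewrite (le_trans (ler_cmodB _ _)) // lerD //.
  rewrite (le_trans (ler_cmod_sum _ _ _)) //.
  apply: le_trans (cmod_kernel_row n (window_uniq L)).
  by apply: ler_sum => k _; rewrite cmodM ler_piMr ?cmod_ge0.
by rewrite cmodM cmod_real -[leRHS]mulr1 ler_pM ?cmod_ge0 // muK.
Qed.

(* The eigenvalue equation says that the left-hand vector is [- kernel phi];
   the bound is uniform in [L], so the limit lies in [domL0]. *)
Lemma truncated_domain L (phi : int -> int -> R[i]) (mu : int -> R) m :
  (m \in window L -> \sum_(n <- window L) phi m n * conjc (phi m n) = 1) ->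
  (forall n, m \in window L -> n \in window L ->
        \sum_(k <- window L) kernel n k * phi m k + n%:~R * phi m n =
        (mu m)%:C * phi m n) ->
  m \in window L ->
  \sum_(n <- window L) cmod ((n%:~R - (mu m)%:C) * phi m n) ^+ 2 <= K ^+ 2.
Proof.
move=> on eig mL.
have row n (s : seq int) : uniq s -> \sum_(k <- s) cmod (kernel k n) <= K.
  move=> us; rewrite (le_trans _ (cmod_kernel_row n us)) //.
  by apply: ler_sum => k _; rewrite kernel_conj cmod_conj.
have := @schur_test R (dom L) (fun i j => kernel (pos i) (pos j)) K
  (fun i => phi m (pos i)).
rewrite -(sum_window L (fun n => cmod (phi m n) ^+ 2)).
have -> : \sum_(n <- window L) cmod (phi m n) ^+ 2 = 1.
  apply: (@complexI R); rewrite rmorph_sum rmorph1 -on //.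
  by apply: eq_bigr => k _; rewrite mulcJ.
rewrite mulr1 => h.
have r1 (i : dom L) : \sum_(j < L.*2.+1) cmod (kernel (pos i) (pos j)) <= K.
  rewrite -(sum_window L (fun k => cmod (kernel (pos i) k))).
  exact: (cmod_kernel_row _ (window_uniq L)).
have r2 (j : dom L) : \sum_(i < L.*2.+1) cmod (kernel (pos i) (pos j)) <= K.
  rewrite -(sum_window L (fun k => cmod (kernel k (pos j)))).
  exact: (row _ _ (window_uniq L)).
apply: le_trans (h r1 r2).
rewrite sum_window le_eqVlt; apply/orP; left; apply/eqP.
apply: eq_bigr => i _; rewrite -/(pos i); congr (_ ^+ 2).
rewrite -(sum_window L (fun k => kernel (pos i) k * phi m k)).
have iL : pos i \in window L.
  by rewrite mem_window /pos; have := ltn_ord i; lia.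
by rewrite mulrBl -(eig _ mL iL) opprD addrA addrAC subrr sub0r cmodN.
Qed.

End Truncation.

(** * Limits along an ultrafilter *)

Section UltraLimit.
Variables (R : realType) (F : set_system nat).
Hypothesis UF : UltraFilter F.
Implicit Types (u v : nat -> R[i]) (z w : R[i]).

(** Compactness of [[-M, M]] in ultrafilter form, applied to the image of [F], which is again an
    ultrafilter. *)
Lemma bounded_ultra_cvg (u : nat -> R) M : (forall L, `|u L| <= M) ->
  exists l : R, u @ F --> l.
Proof.
move=> uM; have := @segment_compact R (- M) M; rewrite compact_ultra.
have UuF : UltraFilter (u @ F).
  split=> [|G PG FG]; first exact: fmap_proper_filter.
  apply/seteqP; split=> // A GA.
  have [//|nA] := in_ultra_setVsetC (u @^-1` A) UF.
  by have [y []] := filter_ex (filterI GA (FG (~` A) nA)).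
move=> /(_ (u @ F) UuF) [|l [_ ul]]; last by exists l.
by apply: (@filterE _ F) => L /=; rewrite in_itv /= -ler_norml.
Qed.

Definition ccvg u z := ((fun L => complex.Re (u L)) @ F --> complex.Re z) /\
  ((fun L => complex.Im (u L)) @ F --> complex.Im z).

Lemma bounded_ultra_ccvg u M : (forall L, cmod (u L) <= M) ->
  exists z, ccvg u z.
Proof.
move=> uM.
have [|r hr] := @bounded_ultra_cvg (fun L => complex.Re (u L)) M.
  by move=> L; exact: le_trans (ler_Re_cmod _) (uM L).
have [|i hi] := @bounded_ultra_cvg (fun L => complex.Im (u L)) M.
  by move=> L; exact: le_trans (ler_Im_cmod _) (uM L).
by exists (r +i* i).
Qed.

Lemma ccvg_cst z : ccvg (fun=> z) z.
Proof. by split; exact: cvg_cst. Qed.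

Lemma ccvgD u v z w : ccvg u z -> ccvg v w -> ccvg (fun L => u L + v L) (z + w).
Proof.
move=> [uz uz'] [vw vw']; split.
  by rewrite ReD; under eq_fun do rewrite ReD; exact: cvgD.
by rewrite ImD; under eq_fun do rewrite ImD; exact: cvgD.
Qed.

Lemma ccvgN u z : ccvg u z -> ccvg (fun L => - u L) (- z).
Proof.
move=> [uz uz']; split.
  by rewrite ReN; under eq_fun do rewrite ReN; exact: cvgN.
by rewrite ImN; under eq_fun do rewrite ImN; exact: cvgN.
Qed.

Lemma ccvgB u v z w : ccvg u z -> ccvg v w -> ccvg (fun L => u L - v L) (z - w).
Proof. by move=> uz vw; apply: ccvgD => //; exact: ccvgN. Qed.

Lemma ccvgM u v z w : ccvg u z -> ccvg v w -> ccvg (fun L => u L * v L) (z * w).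
Proof.
move=> [uz uz'] [vw vw']; split.
  by rewrite ReM; under eq_fun do rewrite ReM; apply: cvgB; exact: cvgM.
by rewrite ImM; under eq_fun do rewrite ImM; apply: cvgD; exact: cvgM.
Qed.

Lemma ccvg_conj u z : ccvg u z -> ccvg (fun L => conjc (u L)) (conjc z).
Proof.
have h w : complex.Re (conjc w) = complex.Re w by case: w.
have h' w : complex.Im (conjc w) = - complex.Im w by case: w.
move=> [uz uz']; split.
  by rewrite h; under eq_fun do rewrite h.
by rewrite h'; under eq_fun do rewrite h'; exact: cvgN.
Qed.

Lemma ccvg_real (u : nat -> R) (r : R) : u @ F --> r ->
  ccvg (fun L => (u L)%:C) r%:C.
Proof. by move=> ur; split => //=; exact: cvg_cst. Qed.

Lemma ccvg_sum (I : Type) (s : seq I) (u : I -> nat -> R[i]) (z : I -> R[i]) :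
  (forall i, ccvg (u i) (z i)) ->
  ccvg (fun L => \sum_(i <- s) u i L) (\sum_(i <- s) z i).
Proof.
move=> uz; elim: s => [|i s IH].
  by rewrite big_nil; under eq_fun do rewrite big_nil; exact: ccvg_cst.
by rewrite big_cons; under eq_fun do rewrite big_cons; exact: ccvgD.
Qed.

Lemma ccvg_sqr_cmod u z : ccvg u z ->
  (fun L => cmod (u L) ^+ 2) @ F --> cmod z ^+ 2.
Proof.
move=> [uz uz']; rewrite sqr_cmod; under eq_fun do rewrite sqr_cmod.
by apply: cvgD; rewrite !expr2; under eq_fun do rewrite expr2; exact: cvgM.
Qed.

(** Closed bounds valid [F]-eventually survive in the limit. The proof squares, because the squared
    modulus is polynomial in the two components on which [ccvg] is defined. *)
Lemma ccvg_cmod_le u z e : ccvg u z -> (\forall L \near F, cmod (u L) <= e) ->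
  cmod z <= e.
Proof.
move=> /ccvg_sqr_cmod uz ue.
have [L Le] : exists L, cmod (u L) <= e by exact: filter_ex ue.
have e0 : 0 <= e by exact: le_trans (cmod_ge0 _) Le.
rewrite -(ler_pXn2r (n := 2)) ?nnegrE ?cmod_ge0 //.
apply: cvgr_to_le uz _; apply: filterS ue => {Le}L Le.
by rewrite ler_pXn2r ?nnegrE ?cmod_ge0.
Qed.

Lemma ccvg_scaled_cmod_le (c : R) u z e : 0 <= c -> ccvg u z ->
  (\forall L \near F, c * cmod (u L) <= e) -> c * cmod z <= e.
Proof.
move=> c0 uz ue; have -> : c * cmod z = cmod (c%:C * z).
  by rewrite cmodM cmod_real ger0_norm.
apply: (ccvg_cmod_le (u := fun L => c%:C * u L)).
  by apply: ccvgM => //; exact: ccvg_cst.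
by apply: filterS ue => L; rewrite cmodM cmod_real ger0_norm.
Qed.

End UltraLimit.

(** * An eigenbasis of the full operator *)

Section LimitEigenbasis.
Variables (R : realType) (a : int -> R[i]) (b : int -> R) (x B : R).
Hypothesis aH : forall m : int, a m = conjc (a (- m)).
Hypothesis ax : bounded_sum (fun n => cmod (a n)) x.
Hypothesis bB : forall n : int, `|b n| <= B.

Let K := x + B.
Let G := 1 + 2 * K.

Let x_ge0 : 0 <= x.
Proof. by apply: bounded_sum_ge0 ax => n; exact: cmod_ge0. Qed.

Let B_ge0 : 0 <= B. Proof. exact: le_trans (bB 0). Qed.

Let G_ge0 : 0 <= G. Proof. by rewrite addr_ge0 // mulr_ge0 // addr_ge0. Qed.

Let cmod_a_le n : cmod (a n) <= x.
Proof. by apply: bounded_sum_term ax => ?; exact: cmod_ge0. Qed.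

Let bounded_shift n : bounded_sum (fun k => cmod (a (n - k))) x.
Proof.
apply: (@bounded_sum_inj _ (fun k => cmod (a k)) x (fun k => n - k)) => //.
  by move=> k; exact: cmod_ge0.
by move=> i j /addrI/oppr_inj.
Qed.

Lemma sum_kernel L n (u : int -> R[i]) : n \in window L ->
  \sum_(k <- window L) kernel a b n k * u k =
  \sum_(k <- window L) a (n - k) * u k + (b n)%:C * u n.
Proof.
move=> nL; under eq_bigr => k _ do rewrite /kernel mulrDl.
rewrite big_split /=; congr (_ + _).
rewrite (sum_window_delta (k := n)) ?eqxx ?mulr1 // => k kn.
by rewrite eq_sym (negbTE kn) mulr0 mul0r.
Qed.

Section Limit.
Variables (muL : nat -> int -> R) (phiL : nat -> int -> int -> R[i]).
Hypothesis muK : forall L m, `|muL L m - m%:~R| <= K.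
Hypothesis onL : forall L m m', m \in window L -> m' \in window L ->
  \sum_(n <- window L) phiL L m n * conjc (phiL L m' n) = (m == m')%:R.
Hypothesis coL : forall L n n', n \in window L -> n' \in window L ->
  \sum_(m <- window L) phiL L m n * conjc (phiL L m n') = (n == n')%:R.
Hypothesis eigL : forall L m n, m \in window L -> n \in window L ->
  \sum_(k <- window L) kernel a b n k * phiL L m k + n%:~R * phiL L m n =
  (muL L m)%:C * phiL L m n.
Hypothesis phiL0 : forall L m n,
  (m \notin window L) || (n \notin window L) -> phiL L m n = 0.
Variables (F : set_system nat) (mu : int -> R) (phi : int -> int -> R[i]).
Hypothesis UF : UltraFilter F.
Hypothesis F_infty : \oo `<=` F.
Hypothesis mu_lim : forall m, (fun L => muL L m) @ F --> mu m.
Hypothesis phi_lim : forall m n, ccvg F (fun L => phiL L m n) (phi m n).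

Let near_ge N : \forall L \near F, (N <= L)%N.
Proof. by apply: F_infty; exact: nbhs_infty_ge. Qed.

Let near_mem n : \forall L \near F, n \in window L.
Proof. by apply: filterS (near_ge `|n|%N) => L; rewrite mem_window. Qed.

Let phiL1 L m n : cmod (phiL L m n) <= 1.
Proof.
apply: (@orthonormal_le1 _ L) => [mL|]; last exact: phiL0.
by rewrite onL // eqxx.
Qed.

Let phiL_decay L m n : (1 + `|(n - m)%:~R|) * cmod (phiL L m n) <= G.
Proof. exact: (truncated_decay ax bB (phiL1 L) (@phiL0 L) (muK L m) (@eigL L m n)). Qed.

Lemma limit_shift m : `|mu m - m%:~R| <= K.
Proof.
rewrite -cmod_real; apply: (ccvg_cmod_le UF (u := fun L => (muL L m - m%:~R)%:C)).
  by apply: ccvg_real; apply: cvgB => //; exact: cvg_cst.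
by apply: filterE => L; rewrite cmod_real.
Qed.

Lemma limit_le1 m n : cmod (phi m n) <= 1.
Proof. by apply: (ccvg_cmod_le UF (phi_lim m n)); exact: filterE. Qed.

Lemma limit_decay m n : (1 + `|(n - m)%:~R|) * cmod (phi m n) <= G.
Proof.
apply: (ccvg_scaled_cmod_le UF _ (phi_lim m n)); first by rewrite addr_ge0.
exact: filterE.
Qed.

Let invsqD_tail (j k : int) (e : R) : 0 < e ->
  exists M, small_tail (fun n => G * G / 2 * (invsq R (n - j) + invsq R (n - k))) M e.
Proof.
apply: bounded_sum_small_tail => [n|].
  by rewrite mulr_ge0 ?addr_ge0 ?invsq_ge0 // divr_ge0 ?mulr_ge0.
apply: bounded_sumZ; first by rewrite divr_ge0 ?mulr_ge0.
by apply: bounded_sumD; exact: bounded_sum_invsqB.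
Qed.

(** Stated with window sums, so that finitely many such relations combine linearly without handling
    [csumZ]. *)
Lemma limit_orthonormal m m' (e : R) : 0 < e ->
  exists M0, forall M, (M0 <= M)%N ->
  cmod (\sum_(n <- window M) phi m n * conjc (phi m' n) - (m == m')%:R) <= e.
Proof.
move=> e0; have [M0 hM0] := invsqD_tail m m' e0.
exists M0 => M /small_tail_leq/(_ hM0) hM.
apply: (ccvg_cmod_le UF (u := fun L =>
    \sum_(n <- window M) phiL L m n * conjc (phiL L m' n) - (m == m')%:R)).
  apply: ccvgB; last exact: ccvg_cst.
  by apply: ccvg_sum => n; apply: ccvgM => //; exact: ccvg_conj.
(* Over the whole window [L] the relation is exact; only the part beyond [M] is left, with a
   majorant that does not involve [L]. *)
near=> L; rewrite -(onL (L := L)); [|by near: L..].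
rewrite -opprB cmodN; apply: cmod_sum_windowB; last by near: L.
apply: small_tail_le hM => n; rewrite cmodM cmod_conj.
by apply: invsq_mul => //; exact: cmod_ge0.
Unshelve. all: by end_near. Qed.

Let cvg_sum_seq (s : seq int) (g : nat -> int -> R) (f : int -> R) :
  (forall n, (fun L => g L n) @ F --> f n) ->
  (fun L => \sum_(n <- s) g L n) @ F --> \sum_(n <- s) f n.
Proof.
move=> gf; elim: s => [|n s IH].
  by rewrite big_nil; under eq_fun do rewrite big_nil; exact: cvg_cst.
by rewrite big_cons; under eq_fun do rewrite big_cons; exact: cvgD.
Qed.

Let bounded_sum_limit (g : nat -> int -> R) (f : int -> R) M :
  (forall n, (fun L => g L n) @ F --> f n) ->
  (forall N, \forall L \near F, \sum_(n <- window N) g L n <= M) ->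
  bounded_sum f M.
Proof. by move=> gf gM N; apply: cvgr_to_le (cvg_sum_seq gf) (gM N). Qed.

Let sub_windows N L : (N <= L)%N -> {subset window N <= window L}.
Proof. by move=> NL n; rewrite !mem_window => /leq_trans->. Qed.

(** Before the limit, the remainder is the combination of the [phiL L m] with [m] beyond [M]. By
    Parseval its squared norm is the sum of their [|phi_m(k)|^2], a tail in [m] that is small
    uniformly in [L]. *)
Lemma limit_completeness k (e : R) : 0 < e -> exists M0, forall M, (M0 <= M)%N ->
  bounded_sum (fun n => cmod (delta R k n -
    \sum_(m <- window M) conjc (phi m k) * phi m n) ^+ 2) e.
Proof.
move=> e0.
have [||M0 hM0] := @bounded_sum_small_tail _ (fun m => G ^+ 2 * invsq R (k - m))
    (G ^+ 2 * 4) e _ _ e0.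
- by move=> m; rewrite mulr_ge0 ?exprn_ge0 ?invsq_ge0.
- by apply: bounded_sumZ; rewrite ?exprn_ge0 //; exact: bounded_sum_invsqBr.
exists M0 => M /small_tail_leq/(_ hM0) hM.
apply: (bounded_sum_limit (g := fun L n => cmod (delta R k n -
    \sum_(m <- window M) conjc (phiL L m k) * phiL L m n) ^+ 2)).
  move=> n; apply: ccvg_sqr_cmod; apply: ccvgB; first exact: ccvg_cst.
  by apply: ccvg_sum => m; apply: ccvgM => //; exact: ccvg_conj.
move=> N; near=> L.
have ML : (M <= L)%N by near: L.
have NL : (N <= L)%N by near: L.
have kL : k \in window L by near: L.
apply: le_trans (ler_sum_uniq _ (window_uniq N) (sub_windows NL)) _.
  by move=> n; exact: sqr_ge0.
set s := [seq m <- window L | m \notin window M].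
have E n : n \in window L -> delta R k n -
    \sum_(m <- window M) conjc (phiL L m k) * phiL L m n =
    \sum_(m <- s) conjc (phiL L m k) * phiL L m n.
  move=> nL; rewrite -sum_windowB // /delta -(coL (L := L)) //.
  by congr (_ - _); apply: eq_bigr => m _; rewrite mulrC.
have -> : \sum_(n <- window L) cmod (delta R k n -
    \sum_(m <- window M) conjc (phiL L m k) * phiL L m n) ^+ 2 =
    \sum_(m <- s) cmod (phiL L m k) ^+ 2.
  apply: (@complexI R); rewrite !rmorph_sum /=.
  rewrite (eq_big_seq (fun n => (\sum_(m <- s) conjc (phiL L m k) * phiL L m n) *
      conjc (\sum_(m <- s) conjc (phiL L m k) * phiL L m n))).
    rewrite sum_orthonormal ?window_tail_uniq //.
      by apply: eq_bigr => m _; rewrite conjcK mulrC mulcJ.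
    by move=> m m'; rewrite !mem_filter => /andP[_ mL] /andP[_ mL']; exact: onL.
  by move=> n nL; rewrite E // mulcJ.
apply: le_trans (hM s (window_tail_uniq _ _) _); last first.
  by move=> n; rewrite mem_filter => /andP[].
by apply: ler_sum => m _; apply: sqr_le_invsq => //; exact: cmod_ge0.
Unshelve. all: by end_near. Qed.

Lemma limit_eigen_equation m n :
  csumZ (fun k => a (n - k) * phi m k) =
  (mu m)%:C * phi m n - n%:~R * phi m n - (b n)%:C * phi m n.
Proof.
apply: (csumZ_eq (g := fun k => cmod (a (n - k))) (M := x)) => //.
  by move=> k; rewrite cmodM ler_piMr ?cmod_ge0 ?limit_le1.
move=> N e hN.
apply: (ccvg_cmod_le UF (u := fun L => (muL L m)%:C * phiL L m n -
  n%:~R * phiL L m n - (b n)%:C * phiL L m n -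
  \sum_(k <- window N) a (n - k) * phiL L m k)).
  apply: ccvgB; last by apply: ccvg_sum => k; apply: ccvgM => //; exact: ccvg_cst.
  apply: ccvgB; last by apply: ccvgM => //; exact: ccvg_cst.
  apply: ccvgB; last by apply: ccvgM => //; exact: ccvg_cst.
  by apply: ccvgM => //; exact: ccvg_real.
near=> L.
have mL : m \in window L by near: L.
have nL : n \in window L by near: L.
have NL : (N <= L)%N by near: L.
rewrite -eigL // sum_kernel // addrK addrK; apply: cmod_sum_windowB => //.
by apply: small_tail_le hN => k; rewrite cmodM ler_piMr ?cmod_ge0.
Unshelve. all: by end_near. Qed.

Lemma limit_domL0 m : domL0 (phi m).
Proof.
have phi2 : bounded_sum (fun n => cmod (phi m n) ^+ 2) (G ^+ 2 * 4).
  apply: (bounded_sum_le (f := fun n => G ^+ 2 * invsq R (n - m))) => [n|]; last first.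
    by apply: bounded_sumZ; rewrite ?exprn_ge0 //; exact: bounded_sum_invsqB.
  by apply: sqr_le_invsq => //; [exact: cmod_ge0|exact: limit_decay].
split; first by apply: (bounded_sum_lt_pinfty _ phi2) => n; exact: sqr_ge0.
(* A Fatou argument: on a fixed window [N] the truncated bound holds as soon as [L >= N], hence also
   in the limit. *)
have d2 : bounded_sum (fun n => cmod ((n%:~R - (mu m)%:C) * phi m n) ^+ 2) (K ^+ 2).
  apply: (bounded_sum_limit (g := fun L n =>
      cmod ((n%:~R - (muL L m)%:C) * phiL L m n) ^+ 2)).
    move=> n; apply: ccvg_sqr_cmod; apply: ccvgM => //; apply: ccvgB.
      exact: ccvg_cst.
    exact: ccvg_real.
  move=> N; near=> L.
  have mL : m \in window L by near: L.
  have NL : (N <= L)%N by near: L.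
  apply: le_trans (ler_sum_uniq _ (window_uniq N) (sub_windows NL)) _.
    by move=> n; exact: sqr_ge0.
  apply: (truncated_domain aH ax bB) => // [_|n mL' nL]; last exact: eigL.
  by rewrite onL // eqxx.
apply: (bounded_sum_lt_pinfty (M := 2 * K ^+ 2 + 2 * mu m ^+ 2 * (G ^+ 2 * 4))).
  by move=> n; rewrite mulr_ge0 ?sqr_ge0.
apply: bounded_sum_le (bounded_sumD (bounded_sumZ _ d2) (bounded_sumZ _ phi2)).
- move=> n /=; rewrite -cmod_intr -exprMn -cmodM.
  have -> : n%:~R * phi m n = (n%:~R - (mu m)%:C) * phi m n + (mu m)%:C * phi m n.
    by ring.
  apply: le_trans (sqr_cmodD _ _) _.
  have -> : cmod ((mu m)%:C * phi m n) ^+ 2 = mu m ^+ 2 * cmod (phi m n) ^+ 2.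
    by rewrite cmodM exprMn cmod_real real_normK ?num_real.
  by rewrite mulrA.
- by [].
- by rewrite mulr_ge0 ?sqr_ge0.
Unshelve. all: by end_near. Qed.

Lemma limit_eigspace m : eigspace (@domL0 R) (L0b a b) (mu m)%:C (phi m).
Proof.
split; first exact: limit_domL0.
by move=> n; rewrite /L0b /L0 limit_eigen_equation; ring.
Qed.

(** * Eigenvectors of the full operator as combinations of the limits *)

Section Span.
Variables (y : R) (u : int -> R[i]) (U : R).
Hypothesis uU : bounded_sum (fun n => cmod (u n)) U.
Hypothesis u_eig : forall n, L0b a b u n = y%:C * u n.

Let defect L k := \sum_(j <- window L) kernel a b k j * u j + k%:~R * u k -
  y%:C * u k.

(* [u] is summable because [domL0] is contained in l^1; hence its restriction
   to a window solves the truncated equation up to a small l^1 error. *)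
Lemma truncation_defect (e : R) : 0 < e -> exists L1, forall L, (L1 <= L)%N ->
  \sum_(k <- window L) cmod (defect L k) <= 3 * x * e.
Proof.
move=> e0; have [|L1 hL1] := bounded_sum_small_tail _ uU e0.
  by move=> n; exact: cmod_ge0.
exists L1 => L /small_tail_leq/(_ hL1) hL.
(* In each row the full convolution is replaced by a sum over a larger window [J]. The tolerance is
   divided by the number of rows, so these errors add up to [2 * x * e]; the indices between [L] and
   [J] contribute another [x * e]. *)
have N0 : 0 < (size (window L))%:R :> R by rewrite ltr0n size_map size_iota.
have d0 : 0 < e / (size (window L))%:R by rewrite divr_gt0.
have [|J0 hJ0] := bounded_sum_small_tail _ uU d0; first by move=> n; exact: cmod_ge0.
pose J := maxn J0 L.
have hJ : small_tail (fun n => cmod (u n)) J (e / (size (window L))%:R).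
  by apply: small_tail_leq hJ0; exact: leq_maxl.
have LJ : (L <= J)%N by exact: leq_maxr.
set s := [seq j <- window J | j \notin window L].
have row k : k \in window L -> cmod (defect L k) <=
    2 * (x * (e / (size (window L))%:R)) +
    \sum_(j <- s) cmod (a (k - j)) * cmod (u j).
  move=> kL.
  have -> : defect L k = - (csumZ (fun j => a (k - j) * u j) -
      \sum_(j <- window J) a (k - j) * u j) - \sum_(j <- s) a (k - j) * u j.
    rewrite -sum_windowB // /defect -u_eig /L0b /L0 sum_kernel //.
    by ring.
  rewrite (le_trans (ler_cmodB _ _)) // cmodN lerD //.
    apply: (csumZ_window (g := fun j => x * cmod (u j)) (M := x * U)).
    - by move=> j; rewrite cmodM ler_wpM2r ?cmod_ge0.
    - exact: bounded_sumZ.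
    - by move=> t ut tJ; rewrite -mulr_sumr ler_wpM2l // hJ.
  by rewrite (le_trans (ler_cmod_sum _ _ _)) //; apply: ler_sum => j _; rewrite cmodM.
apply: (@le_trans _ _ (\sum_(k <- window L) (2 * (x * (e / (size (window L))%:R)) +
    \sum_(j <- s) cmod (a (k - j)) * cmod (u j)))).
  by rewrite big_seq [leRHS]big_seq; exact: ler_sum.
rewrite big_split /= big_const_seq count_predT iter_addr_0 -[_ *+ size _]mulr_natr.
have -> : 2 * (x * (e / (size (window L))%:R)) * (size (window L))%:R = 2 * (x * e).
  by field; rewrite gt_eqF.
suff : \sum_(k <- window L) \sum_(j <- s) cmod (a (k - j)) * cmod (u j) <= x * e.
  by lra.
rewrite exchange_big /=; apply: (@le_trans _ _ (\sum_(j <- s) x * cmod (u j))).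
  apply: ler_sum => j _; rewrite -mulr_suml ler_wpM2r ?cmod_ge0 //.
  rewrite -(big_map (fun k => k - j) xpredT (fun k => cmod (a k))).
  apply: (bounded_sum_seq _ ax) => [k|]; first exact: cmod_ge0.
  by rewrite map_inj_uniq ?window_uniq // => i i' /addIr.
rewrite -mulr_sumr ler_wpM2l // hL ?window_tail_uniq // => n.
by rewrite mem_filter => /andP[].
Qed.

Let coef L m := \sum_(k <- window L) u k * conjc (phiL L m k).

Let coef_le L m : cmod (coef L m) <= U.
Proof.
rewrite (le_trans (ler_cmod_sum _ _ _)) // (le_trans _ (uU L)) //.
by apply: ler_sum => k _; rewrite cmodM cmod_conj ler_piMr ?cmod_ge0.
Qed.

(** Pair the defect with [phiL L m] and move the Hermitian kernel to the other side: [u] nearly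
    solves the equation for [y], [phiL L m] solves it for [muL L m]. *)
Let coef_defect L m : m \in window L ->
  cmod ((muL L m - y)%:C * coef L m) <= \sum_(k <- window L) cmod (defect L k).
Proof.
move=> mL.
have -> : (muL L m - y)%:C * coef L m =
    \sum_(k <- window L) defect L k * conjc (phiL L m k).
  rewrite /defect; under [RHS]eq_bigr => k _ do
    rewrite !mulrDl mulr_suml mulNr -addrA.
  rewrite big_split exchange_big /=.
  under [X in _ = X + _]eq_bigr => j _ do
    under eq_bigr => k _ do rewrite kernel_conj // mulrAC -rmorphM mulrC.
  under [X in _ = X + _]eq_bigr => j _ do rewrite -mulr_sumr -rmorph_sum.
  rewrite -big_split /= rmorphB mulrBl /coef !mulr_sumr -sumrB.
  apply: eq_big_seq => k kL /=.
  have := eigL mL kL => /(congr1 (@conjc R)).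
  rewrite rmorphD rmorphM rmorphM /= oppr0 => h.
  have -> : conjc (\sum_(i <- window L) kernel a b k i * phiL L m i) =
     (muL L m)%:C * conjc (phiL L m k) - k%:~R * conjc (phiL L m k).
    rewrite -[(muL L m)%:C * _]h rmorph_int addrK //.
  ring.
rewrite (le_trans (ler_cmod_sum _ _ _)) //; apply: ler_sum => k _.
by rewrite cmodM cmod_conj ler_piMr ?cmod_ge0.
Qed.

(** By [coef_defect], coefficients at [mu m != y] tend to 0. For large [m] they are moreover divided
    by a quantity of order [|m|], which together with the decay of [phi m n] makes the sum over all
    these [m] small uniformly in [L]; so a fixed finite window is enough. *)
Lemma limit_span : exists (M0 : nat) (c : int -> R[i]),
  (forall m, mu m != y -> c m = 0) /\
  forall n, u n = \sum_(m <- window M0) c m * phi m n.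
Proof.
have /choice[c c_lim] : forall m, exists z, ccvg F (fun L => coef L m) z.
  by move=> m; apply: (bounded_ultra_ccvg UF (M := U)) => L; exact: coef_le.
(* For [|m| > 1 + 2 K + 2 |y|] one has [|m| - K - |y| >= (1 + |m|) / 2], hence a divisor of order
   [|m|]. *)
pose M0 := Num.bound (1 + 2 * K + 2 * `|y|).
have K_ge0 : 0 <= K by exact: addr_ge0.
have hM0 L m : m \notin window M0 -> 1 + `|m%:~R| <= 2 * `|muL L m - y|.
  rewrite mem_window -ltnNge => Mm.
  have h1 : 1 + 2 * K + 2 * `|y| < `|m%:~R|.
    rewrite -intr_norm -natr_absz; apply: lt_trans (_ : M0%:R < _); last by rewrite ltr_nat.
    by apply: archi_boundP; rewrite !addr_ge0 // mulr_ge0.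
  have h2 := muK L m.
  have : `|m%:~R| <= `|muL L m - y| + `|muL L m - m%:~R| + `|y| :> R.
    rewrite -[X in `|X|](_ : (muL L m - y) - (muL L m - m%:~R) + y = _); last by ring.
    by rewrite (le_trans (ler_normD _ _)) // lerD2r ler_normB.
  lra.
exists M0, c; split=> [m my|n].
  suff : (mu m - y)%:C * c m = 0.
    by move=> /eqP; rewrite mulf_eq0 => /orP[/eqP[/eqP]|/eqP//]; rewrite subr_eq0 (negbTE my).
  apply: cmod0_eq0; apply/eqP; rewrite eq_le cmod_ge0 andbT.
  apply/ler_addgt0Pl => e e0; rewrite addr0.
  have e' : 0 < e / (3 * x + 1) by rewrite divr_gt0 // ltr_wpDl ?mulr_ge0.
  have [L1 hL1] := truncation_defect e'.
  apply: (ccvg_cmod_le UF (u := fun L => (muL L m - y)%:C * coef L m)).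
    apply: ccvgM => //; apply: ccvg_real; apply: cvgB => //; exact: cvg_cst.
  near=> L; apply: le_trans (coef_defect _) _; first by near: L.
  apply: le_trans (hL1 _ _) _; first by near: L.
  by rewrite mulrCA ger_pMr // ler_pdivrMr; have := x_ge0; lra.
apply/eqP; rewrite -subr_eq0; apply/eqP/cmod0_eq0; apply/eqP.
rewrite eq_le cmod_ge0 andbT; apply/ler_addgt0Pl => e e0; rewrite addr0.
(* The sum beyond [M0] will be at most [2 T * (G / 2) * 8 = 8 T G] with [T <= 3 x e']; the summand 1
   keeps the denominator positive. *)
have e' : 0 < e / (24 * x * G + 1) by rewrite divr_gt0 // ltr_wpDl ?mulr_ge0.
have [L1 hL1] := truncation_defect e'.
apply: (ccvg_cmod_le UF (u := fun L => u n -
    \sum_(m <- window M0) coef L m * phiL L m n)).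
  apply: ccvgB; first exact: ccvg_cst.
  by apply: ccvg_sum => m; exact: ccvgM.
near=> L.
have nL : n \in window L by near: L.
have ML : (M0 <= L)%N by near: L.
have /hL1 {hL1} : (L1 <= L)%N by near: L.
set T := \sum_(k <- _) _ => hT.
have T0 : 0 <= T by apply: sumr_ge0 => k _; exact: cmod_ge0.
(* On the window the truncated basis is complete, so this expansion is exact. *)
have un : u n = \sum_(m <- window L) coef L m * phiL L m n.
  under eq_bigr => m _ do rewrite mulr_suml.
  rewrite exchange_big /=.
  rewrite (eq_big_seq (fun k => u k * (n == k)%:R)) => [|k kL].
    rewrite (sum_window_delta (k := n)) ?eqxx ?mulr1 // => k kn.
    by rewrite eq_sym (negbTE kn) mulr0.
  rewrite -(coL nL kL) mulr_sumr; apply: eq_bigr => m _; ring.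
rewrite {1}un sum_windowB //; set s := [seq m <- _ | _].
rewrite (le_trans (ler_cmod_sum _ _ _)) //.
have ms m : m \in s -> cmod (coef L m * phiL L m n) <=
    2 * T * (G / 2 * (invsq R m + invsq R (n - m))).
  move=> mem_m; rewrite cmodM (le_trans (invsq_mul (m := m) (n := n - m)
    (X := 2 * T) _ G_ge0 _ _ _ _)) ?cmod_ge0 ?mulr_ge0 //; last by lra.
  have [mM mL] : m \notin window M0 /\ m \in window L.
    by move: mem_m; rewrite mem_filter => /andP.
  have := coef_defect mL; rewrite cmodM cmod_real -/T => h.
  apply: (@le_trans _ _ (2 * `|muL L m - y| * cmod (coef L m))); last by lra.
  by rewrite ler_wpM2r ?cmod_ge0 // hM0.
apply: (@le_trans _ _ (2 * T * (G / 2 * (4 + 4)))).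
  rewrite (@le_trans _ _ (\sum_(m <- s) 2 * T * (G / 2 * (invsq R m + invsq R (n - m))))) //.
    by rewrite big_seq [leRHS]big_seq; exact: ler_sum.
  rewrite -!mulr_sumr big_split /= ler_wpM2l ?mulr_ge0 // ler_wpM2l ?divr_ge0 // lerD //.
    apply: bounded_sum_seq (bounded_sum_invsq R) (window_tail_uniq _ _) => k.
    exact: invsq_ge0.
  apply: bounded_sum_seq (bounded_sum_invsqBr R n) (window_tail_uniq _ _) => k.
  exact: invsq_ge0.
apply: (@le_trans _ _ (24 * x * G * (e / (24 * x * G + 1)))).
  by have := ler_wpM2r G_ge0 hT; move: (e / _) => e1; lra.
have xG : 0 <= x * G by exact: mulr_ge0.
by rewrite mulrCA ger_pMr // ler_pdivrMr; lra.
Unshelve. all: by end_near. Qed.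

End Span.
End Limit.

(** Cauchy-Schwarz against [1 / (1 + |n|)], in the termwise form [t <= p^-2 + p^2 t^2 / 4] with
    [p = 1 + |n|] and [p^2 <= 2 + 2 n^2]. *)
Lemma domL0_summable (u : int -> R[i]) : domL0 u ->
  exists U, bounded_sum (fun n => cmod (u n)) U.
Proof.
move=> [u2 nu2].
have h1 := esum_bounded_sum (f := fun n => cmod (u n) ^+ 2) (fun n => sqr_ge0 _) u2.
have h2 := esum_bounded_sum (f := fun n => `|n%:~R| ^+ 2 * cmod (u n) ^+ 2)
  (fun n => mulr_ge0 (sqr_ge0 _) (sqr_ge0 _)) nu2.
have := bounded_sumD (bounded_sum_invsq R) (bounded_sumD h1 h2).
set U := 4 + _ => hU; exists U; apply: bounded_sum_le hU => n.
rewrite /invsq; have := cmod_ge0 (u n); move: (cmod (u n)) => t t0.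
have : 0 <= `|n%:~R| :> R by []. move: (`|n%:~R| : R) => s s0.
have p0 : 0 < 1 + s by lra.
have := sqr_ge0 ((1 + s)^-1 - (1 + s) * t / 2).
have -> : ((1 + s)^-1 - (1 + s) * t / 2) ^+ 2 =
    (1 + s) ^- 2 - t + (1 + s) ^+ 2 * t ^+ 2 / 4.
  by field; rewrite gt_eqF.
have : 0 <= (1 - s) ^+ 2 * t ^+ 2 by rewrite mulr_ge0 ?sqr_ge0.
have : 0 <= s ^+ 2 * t ^+ 2 by rewrite mulr_ge0 ?sqr_ge0.
have : 0 <= t ^+ 2 by exact: sqr_ge0.
nra.
Qed.

(** The last clause is what identifies multiplicities: the eigenspace of [y] is spanned by the
    [phi m] with [mu m = y]. *)
Theorem exists_eigenbasis : exists (mu : int -> R) (phi : int -> int -> R[i]),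
  [/\ forall m, `|mu m - m%:~R| <= x + B /\ forall n, cmod (phi m n) <= 1,
      forall m, eigspace (@domL0 R) (L0b a b) (mu m)%:C (phi m),
      forall m m' (e : R), 0 < e -> exists M0, forall M, (M0 <= M)%N ->
        cmod (\sum_(n <- window M) phi m n * conjc (phi m' n) - (m == m')%:R) <= e,
      forall k (e : R), 0 < e -> exists M0, forall M, (M0 <= M)%N ->
        bounded_sum (fun n => cmod (delta R k n -
          \sum_(m <- window M) conjc (phi m k) * phi m n) ^+ 2) e
    & forall (y : R) u, eigspace (@domL0 R) (L0b a b) y%:C u ->
      exists (M0 : nat) (c : int -> R[i]), (forall m, mu m != y -> c m = 0) /\
        forall n, u n = \sum_(m <- window M0) c m * phi m n].
Proof.
have /choice[muL] := truncated_eigenbasis aH ax bB.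
move=> /choice[phiL] /all_and5[muK onL coL eigL phiL0].
have [F [UF F_infty]] := ultraFilterLemma (@eventually_filter).
have [mu mu_lim] : exists mu : int -> R, forall m, (fun L => muL L m) @ F --> mu m.
  have /choice[mu h] : forall m, exists l : R, (fun L => muL L m) @ F --> l.
    move=> m; apply: (bounded_ultra_cvg UF (M := K + `|m%:~R|)) => L.
    rewrite -[X in `|X|](subrK m%:~R).
    by rewrite (le_trans (ler_normD _ _)) // lerD2r muK.
  by exists mu.
have phiL1 L m n : cmod (phiL L m n) <= 1.
  apply: (@orthonormal_le1 _ L) => [mL|]; last exact: phiL0.
  by rewrite onL // eqxx.
have [phi phi_lim] : exists phi : int -> int -> R[i],
    forall m n, ccvg F (fun L => phiL L m n) (phi m n).
  have /choice[phi h] : forall m, exists p : int -> R[i],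
      forall n, ccvg F (fun L => phiL L m n) (p n).
    move=> m; have /choice[p h] : forall n, exists z, ccvg F (fun L => phiL L m n) z.
      by move=> n; exact: (bounded_ultra_ccvg UF (M := 1)).
    by exists p.
  by exists phi.
exists mu, phi; split.
- move=> m; split; first exact: (limit_shift muK UF mu_lim).
  exact: (limit_le1 onL phiL0 UF phi_lim).
- exact: (limit_eigspace muK onL eigL phiL0 UF F_infty mu_lim phi_lim).
- exact: (limit_orthonormal muK onL eigL phiL0 UF F_infty phi_lim).
- exact: (limit_completeness muK onL coL eigL phiL0 UF F_infty phi_lim).
move=> y u [/domL0_summable[U uU] u_eig].
exact: (limit_span muK onL coL eigL phiL0 UF F_infty mu_lim phi_lim uU u_eig).
Qed.

End LimitEigenbasis.

(** * Counting eigenvalues *)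

Section Dimension.
Variable R : realType.
Implicit Types (E : set (int -> R[i])).

(** The two change-of-coordinates matrices multiply to the identity because [f] is free, and an
    identity cannot factor through a smaller size. *)
Lemma free_family_size_le (k l : nat) (e : 'I_k -> int -> R[i])
    (f : 'I_l -> int -> R[i]) :
  (forall c : 'I_l -> R[i], (forall n, \sum_j c j * f j n = 0) ->
    forall j, c j = 0) ->
  (forall j, exists c : 'I_k -> R[i], forall n, f j n = \sum_i c i * e i n) ->
  (forall i, exists c : 'I_l -> R[i], forall n, e i n = \sum_j c j * f j n) ->
  (l <= k)%N.
Proof.
move=> ffree /choice[Q fQ] /choice[P eP].
apply: (@mulmx1_min _ _ _ (\matrix_(j, i) Q j i) (\matrix_(i, j) P i j)).
apply/matrixP => j l'; rewrite !mxE; apply/eqP; rewrite -subr_eq0; apply/eqP.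
apply: (ffree (fun l0 => \sum_i (\matrix_(j, i) Q j i) j i *
  (\matrix_(i, j) P i j) i l0 - (j == l0)%:R)) => n.
under eq_bigr => l0 _ do rewrite mulrBl.
rewrite sumrB [X in _ - X](bigD1 j) //= eqxx mul1r [X in _ - (_ + X)]big1 ?addr0.
  under eq_bigr => l0 _ do rewrite mulr_suml.
  rewrite exchange_big /= fQ -sumrB big1 // => i _.
  under eq_bigr => l0 _ do rewrite !mxE -mulrA.
  by rewrite -mulr_sumr -eP subrr.
by move=> l0 l0j; rewrite eq_sym (negbTE l0j) mul0r.
Qed.

Lemma has_dim_uniq E (l : nat) (f : 'I_l -> int -> R[i]) k :
  (forall j, E (f j)) ->
  (forall c : 'I_l -> R[i], (forall n, \sum_j c j * f j n = 0) ->
    forall j, c j = 0) ->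
  (forall u, E u -> exists c : 'I_l -> R[i], forall n, u n = \sum_j c j * f j n) ->
  has_dim E k -> k = l.
Proof.
move=> fE ffree fspan [e eE espan]; apply/eqP; rewrite eqn_leq; apply/andP; split.
  apply: (@free_family_size_le _ _ f e) => [c ce0 i| i | j].
  (* Uniqueness of coordinates gives freeness: adding a relation [c] to the coordinates of [e i]
     yields coordinates of [e i] again. *)
  - have [c0 [_ c0_uniq]] := espan _ (eE i).
    have h1 : [ffun i0 => (i0 == i)%:R] = c0.
      apply/esym/c0_uniq => n; rewrite (bigD1 i) //= ffunE eqxx mul1r big1 ?addr0 //.
      by move=> j ji; rewrite ffunE (negbTE ji) mul0r.
    have h2 : [ffun i0 => (i0 == i)%:R + c i0] = c0.
      apply/esym/c0_uniq => n.
      under eq_bigr => j _ do rewrite ffunE mulrDl.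
      rewrite big_split /= ce0 addr0 (bigD1 i) //= eqxx mul1r big1 ?addr0 //.
      by move=> j ji; rewrite (negbTE ji) mul0r.
    have /ffunP/(_ i) := etrans h1 (esym h2); rewrite !ffunE => /eqP.
    by rewrite -subr_eq0 opprD addrA subrr sub0r oppr_eq0 => /eqP.
  - by have [c h] := fspan _ (eE i); exists c.
  - by have [c [h _]] := espan _ (fE j); exists c.
apply: (@free_family_size_le _ _ e f) => [//| j | i].
- by have [c [h _]] := espan _ (fE j); exists c.
- by have [c h] := fspan _ (eE i); exists c.
Qed.

End Dimension.

(** * Counting integers in intervals and matching fibres *)

Section Counting.
Variable R : realType.

Lemma inj_interval_size (h : nat -> int) (N : nat) (lo hi : R) :
  {in [pred i | (i < N)%N] &, injective h} -> (0 < N)%N ->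
  (forall i, (i < N)%N -> lo <= (h i)%:~R <= hi) -> N%:R <= hi - lo + 1.
Proof.
move=> hinj N0 hN; case: leP => // hlt.
pose c := Num.ceil lo; pose s := [seq absz (h i - c)%R | i <- iota 0 N].
have bnd i : (i < N)%N -> 0 <= h i - c < N%:Z - 1.
  move=> iN; have /andP[h1 h2] := hN i iN.
  rewrite subr_ge0 ceil_le_int h1 /= -(ltr_int R) !rmorphB /=.
  by have := ceil_ge lo; rewrite -/c; lra.
have us : uniq s.
  rewrite map_inj_in_uniq ?iota_uniq // => i j; rewrite !mem_iota /= !add0n => iN jN.
  have := bnd i iN; have := bnd j jN => hj hi' e.
  by apply: hinj => //; lia.
have : (size s <= size (iota 0 N.-1))%N.
  apply: uniq_leq_size us _ => y /mapP[j]; rewrite !mem_iota /= !add0n => jN ->.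
  by have := bnd j jN; lia.
by rewrite size_map !size_iota; lia.
Qed.

(** Each inequality is a pigeonhole argument. The injections [tau] and [sigma] send a run of
    consecutive indices into an interval of integers; monotonicity of [lam] locates that interval,
    whose length then bounds the run. *)
Lemma enumeration_shift (lam mu : int -> R) (sigma tau : int -> int) (K : R) :
  (forall m, `|mu m - m%:~R| <= K) ->
  (forall m n : int, m <= n -> lam m <= lam n) ->
  0 <= lam 0 -> (forall n, 0 <= lam n -> lam 0 <= lam n) ->
  injective sigma -> (forall m, lam (sigma m) = mu m) ->
  injective tau -> (forall n, mu (tau n) = lam n) ->
  forall n, `|lam n - n%:~R| <= 4 * K + 2.
Proof.
move=> muK mono lam0 lam0_min isig sigE itau tauE n.
have K0 : 0 <= K by exact: le_trans (muK 0).
have muK' m : m%:~R - K <= mu m <= m%:~R + K.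
  by have := muK m; rewrite ler_norml; lra.
have tauK j : lam j - K <= (tau j)%:~R <= lam j + K.
  by rewrite -tauE; have := muK' (tau j); lra.
have /andP[fl1 fl2] := floor_itv K.
(* The eigenvalue [mu] at [floor K + 1] is nonnegative, so the minimality of [lam 0] applies to
   it. *)
have lam0_le : lam 0 <= 2 * K + 1.
  have h1 := muK' (Num.floor K + 1); rewrite intrD in h1 fl2.
  have := lam0_min (sigma (Num.floor K + 1)); rewrite sigE => h2.
  apply: (le_trans (h2 _)); lra.
have monoN i j : lam i < lam j -> i < j.
  by move=> h; rewrite ltNge; apply: contraTN h => /mono; rewrite -leNgt.
rewrite ler_norml; case: (leP 0 n) => n0.
  have nE : n = (absz n)%:Z by lia.
  apply/andP; split.
    have := @inj_interval_size tau (absz n).+1 (- K) (lam n + K) _ isT _.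
    have -> : (absz n).+1%:R = n%:~R + 1 :> R by rewrite -natr1 {2}nE.
    move=> h; suff : n%:~R + 1 <= lam n + K - - K + 1 by lra.
    apply: h => [i j _ _ /itau //|i]; first by case.
    rewrite ltnS => ni; have := tauK i.
    have : lam i <= lam n by apply: mono; lia.
    have : lam 0 <= lam i by exact: mono.
    lra.
  rewrite leNgt; apply/negP => hn.
  (* From [p] on, [mu] exceeds [2 K + 1 >= lam 0], and up to [p + n] it is at most [n + 4 K + 2],
     below [lam n] by assumption. Thus [sigma] would place [n + 1] indices strictly between 0 and
     [n]. *)
  pose p := Num.floor (3 * K + 1) + 1.
  have := floor_itv (3 * K + 1); rewrite -/p => /andP[p1 p2].
  have p1' : p%:~R <= 3 * K + 2 by rewrite /p intrD; lra.
  have := @inj_interval_size (fun i => sigma (p + i%:Z)) (absz n).+1 1 (n%:~R - 1) _ isT _.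
  have -> : (absz n).+1%:R = n%:~R + 1 :> R by rewrite -natr1 {2}nE.
  move=> h; suff : n%:~R + 1 <= n%:~R - 1 - 1 + 1 :> R by lra.
  apply: h => [i j _ _ /isig|i]; first by lia.
  rewrite ltnS => ni.
  have ni' : i%:Z%:~R <= n%:~R :> R by rewrite ler_int; lia.
  have i0 : 0 <= i%:Z%:~R :> R by rewrite ler0z.
  have := muK' (p + i%:Z); rewrite intrD => m1.
  have s1 : 0 < sigma (p + i%:Z) by apply: monoN; rewrite sigE; lra.
  have s2 : sigma (p + i%:Z) < n by apply: monoN; rewrite sigE; lra.
  have -> : n%:~R - 1 = (n - 1)%:~R :> R by rewrite intrB.
  by rewrite (ler_int R 1) ler_int; move: s1 s2; clear; lia.
have nE : n = - (absz n)%:Z by lia.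
have nN : (absz n).+1%:R = 1 - n%:~R :> R by rewrite -natr1 [in RHS]nE mulrNz; ring.
apply/andP; split; last first.
  have := @inj_interval_size (fun i => tau (- i%:Z)) (absz n).+1
    (lam n - K) (3 * K + 1) _ isT _.
  rewrite nN.
  move=> h; suff : 1 - n%:~R <= 3 * K + 1 - (lam n - K) + 1 by lra.
  apply: h => [i j _ _ /itau|i]; first by lia.
  rewrite ltnS => ni; have := tauK (- i%:Z).
  have : lam n <= lam (- i%:Z) by apply: mono; lia.
  have : lam (- i%:Z) <= lam 0 by apply: mono; lia.
  lra.
rewrite leNgt; apply/negP => hn.
(* Up to [p] the eigenvalues [mu] are negative, so [sigma] would place [|n| + 1] indices strictly
   between [n] and 0. *)
pose p := - (Num.floor K + 1).
have p1 : p%:~R < - K by rewrite /p mulrNz; lra.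
have p2 : - K - 1 <= p%:~R by rewrite /p mulrNz intrD; lra.
have := @inj_interval_size (fun i => sigma (p - i%:Z)) (absz n).+1 (n%:~R + 1) (- 1) _ isT _.
rewrite nN.
move=> h; suff : 1 - n%:~R <= - 1 - (n%:~R + 1) + 1 :> R by lra.
apply: h => [i j _ _ /isig|i]; first by lia.
rewrite ltnS => ni.
have ni' : i%:Z%:~R <= - n%:~R :> R by rewrite -mulrNz ler_int; lia.
have i0 : 0 <= i%:Z%:~R :> R by rewrite ler0z.
have := muK' (p - i%:Z); rewrite intrB => m1.
have s1 : n < sigma (p - i%:Z) by apply: monoN; rewrite sigE; lra.
have s2 : sigma (p - i%:Z) < 0 by apply: monoN; rewrite sigE; lra.
have -> : n%:~R + 1 = (n + 1)%:~R :> R by rewrite intrD.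
by rewrite -(mulrNz 1 1) !ler_int; move: s1 s2; clear; lia.
Qed.

Lemma card_II_seq (A : set int) k : (A #= `I_k)%card ->
  exists s : seq int, [/\ uniq s, size s = k & forall n, A n <-> n \in s].
Proof.
move=> Ak; have fA : finite_set A by exists k.
exists (fset_set A); split; first exact: fset_uniq.
- exact: card_fset_set.
- by move=> n; rewrite in_fset_set //; split=> [/mem_set|/set_mem].
Qed.

(** The [j]-th index in a fibre of [f] goes to the [j]-th index in the fibre of [g] over the same
    value. *)
Lemma fiber_injection (f g : int -> R) (s t : R -> seq int) :
  (forall y, uniq (s y)) -> (forall y, uniq (t y)) ->
  (forall y, size (s y) = size (t y)) ->
  (forall y m, f m = y <-> m \in s y) -> (forall y m, g m = y <-> m \in t y) ->
  exists2 sigma : int -> int, injective sigma & forall m, g (sigma m) = f m.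
Proof.
move=> us ut st fs gt.
pose sigma m := nth 0 (t (f m)) (index m (s (f m))).
have idx m : (index m (s (f m)) < size (t (f m)))%N.
  by rewrite -st index_mem; apply/fs.
have gs m : g (sigma m) = f m by apply/gt; rewrite mem_nth.
exists sigma => // m m' e; have fe : f m = f m' by rewrite -!gs e.
move: e; rewrite /sigma -fe => /eqP; rewrite nth_uniq ?ut //; last by rewrite fe.
move=> /eqP e; rewrite -(nth_index 0 (proj1 (fs (f m) m) erefl)) e nth_index //.
by apply/fs.
Qed.

End Counting.

(** * Comparison of the two lists of eigenvalues *)

Section EigenvalueShift.
Variables (R : realType) (a : int -> R[i]) (b : int -> R) (x B : R).
Hypothesis aH : forall m : int, a m = conjc (a (- m)).
Hypothesis ax : bounded_sum (fun n => cmod (a n)) x.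
Hypothesis bB : forall n : int, `|b n| <= B.

Theorem eigenvalue_shift (lam : int -> R) :
  eigenvalue_enum (@domL0 R) (L0b a b) lam ->
  forall n, `|lam n - n%:~R| <= 4 * (x + B) + 2.
Proof.
have [mu [phi [mu_phi phi_eig on _ span]]] := exists_eigenbasis aH ax bB.
have muK m : `|mu m - m%:~R| <= x + B by case: (mu_phi m).
have K0 : 0 <= x + B by exact: le_trans (muK 0).
move=> [lam_dim mono _ _ [lam0 lam0_min]].
(* [mu m = y] forces [|m| <= x + B + |y|], so this window contains the whole fibre. *)
pose s (y : R) := [seq m <- window (Num.bound (x + B + `|y|)) | mu m == y].
have us y : uniq (s y) by rewrite filter_uniq ?window_uniq.
have sE y m : mu m = y <-> m \in s y.
  rewrite mem_filter; split=> [my|/andP[/eqP//]].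
  rewrite my eqxx mem_window /= ltnW // -(ltr_nat R).
  apply: le_lt_trans (archi_boundP _); last by rewrite addr_ge0.
  have := muK m; rewrite my natr_absz intr_norm distrC => h.
  by rewrite -[X in `|X|](subrK y) (le_trans (ler_normD _ _)) // lerD2r.
have dim y k : has_dim (eigspace (@domL0 R) (L0b a b) y%:C) k -> k = size (s y).
  apply: (@has_dim_uniq _ _ (size (s y)) (fun j => phi (nth 0 (s y) j))).
  - move=> j; have /sE e : nth 0 (s y) j \in s y by rewrite mem_nth.
    by have := phi_eig (nth 0 (s y) j); rewrite e.
  (* Freeness from approximate orthonormality: pairing the relation with the [j]-th vector leaves
     [c j] up to an error at most [S * e / (S + 1)]. *)
  - move=> c c0 j; apply: cmod0_eq0; apply/eqP; rewrite eq_le cmod_ge0 andbT.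
    apply/ler_addgt0Pl => e e0; rewrite addr0.
    pose S := \sum_i cmod (c i).
    have S0 : 0 <= S by apply: sumr_ge0 => i _; exact: cmod_ge0.
    have e' : 0 < e / (S + 1) by rewrite divr_gt0 // ltr_wpDl.
    have /choice[M0 hM0] : forall i : 'I_(size (s y)), exists M0, forall M, (M0 <= M)%N ->
        cmod (\sum_(n <- window M) phi (nth 0 (s y) i) n *
          conjc (phi (nth 0 (s y) j) n) - (i == j)%:R) <= e / (S + 1).
      move=> i; have [M0 h] := on (nth 0 (s y) i) (nth 0 (s y) j) _ e'.
      exists M0 => M MM; have := h M MM.
      by rewrite nth_uniq ?us ?ltn_ord.
    pose M := (\max_i M0 i)%N.
    have : \sum_i c i * (\sum_(n <- window M) phi (nth 0 (s y) i) n *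
          conjc (phi (nth 0 (s y) j) n)) = 0.
      under eq_bigr => i _ do rewrite mulr_sumr.
      rewrite exchange_big /= big1 // => n _.
      under eq_bigr => i _ do rewrite mulrA.
      by rewrite -mulr_suml c0 mul0r.
    move=> h; have -> : c j = - \sum_i c i * (\sum_(n <- window M)
        phi (nth 0 (s y) i) n * conjc (phi (nth 0 (s y) j) n) - (i == j)%:R).
      under eq_bigr => i _ do rewrite mulrBr.
      rewrite sumrB h sub0r opprK (bigD1 j) //= eqxx mulr1 big1 ?addr0 // => i ij.
      by rewrite (negbTE ij) mulr0.
    rewrite cmodN (le_trans (ler_cmod_sum _ _ _)) //.
    apply: (@le_trans _ _ (\sum_i cmod (c i) * (e / (S + 1)))).
      apply: ler_sum => i _; rewrite cmodM ler_wpM2l ?cmod_ge0 // hM0 //.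
      exact: leq_bigmax.
    rewrite -mulr_suml -/S mulrCA ger_pMr // ler_pdivrMr; lra.
  - move=> u /span[N [c [c0 uE]]].
    exists (fun j => if nth 0 (s y) j \in window N then c (nth 0 (s y) j) else 0) => n.
    transitivity (\sum_(m <- s y) (if m \in window N then c m else 0) * phi m n);
      last by rewrite (big_nth 0) big_mkord.
    rewrite uE (bigID (fun m => mu m == y)) /= [X in _ + X]big1 ?addr0; last first.
      by move=> m /c0->; rewrite mul0r.
    under [RHS]eq_bigr => m _ do rewrite (fun_if (fun z => z * phi m n)) mul0r.
    rewrite -big_mkcond -[LHS]big_filter -[RHS]big_filter.
    apply/perm_big/uniq_perm; rewrite ?filter_uniq ?window_uniq // => m.
    rewrite !mem_filter andbC; congr (_ && _).
    by apply/eqP/idP => [/sE|]; [rewrite mem_filter|move=> ms; apply/sE; rewrite mem_filter].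
have /choice[t tE] : forall y : R, exists t : seq int,
    [/\ uniq t, size t = size (s y) & forall n, lam n = y <-> n \in t].
  move=> y; have [k lk /dim kE] := lam_dim y%:C.
  have [t [ut st tE]] := card_II_seq lk; exists t; split; rewrite ?st //.
  by move=> n; rewrite -tE /=; split=> [->|/complexI].
have ut y : uniq (t y) by case: (tE y).
have st y : size (s y) = size (t y) by case: (tE y).
have lamE y m : lam m = y <-> m \in t y by case: (tE y).
have [sigma isig sigE] := fiber_injection us ut st sE lamE.
have [tau itau tauE] := fiber_injection ut us (fun y => esym (st y)) lamE sE.
exact: (enumeration_shift muK mono lam0 lam0_min isig sigE itau tauE).
Qed.

End EigenvalueShift.

(** * Decay of eigenvectors *)

Section Decay.
Variable R : realType.

(* Multiplying the eigenvalue equation by [|n - m| ^ s] and splitting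
   [|n - m| <= |n - k| + |k - m|] in the convolution gives one more power of
   decay at each step. *)
Fixpoint decay_const (B : R) (s : nat) (x : R) : R :=
  if s is s'.+1 then
    2 ^+ s'.+1 * (x + x * decay_const B s' x) +
      (4 * (x + B) + 2 + B) * decay_const B s' x
  else 1.

Variables (a : int -> R[i]) (b : int -> R) (x B : R).
Hypothesis a0 : a 0 = 0.
Hypothesis bB : forall n : int, `|b n| <= B.

(** Off 0 the weights are powers of integers at least 1, and [a 0 = 0] disposes of the remaining
    term. *)
Lemma weighted_bound_le (r s : nat) : (s <= r)%N ->
  bounded_sum (fun n => cmod (a n) * `|n%:~R| ^+ r) x ->
  bounded_sum (fun n => cmod (a n) * `|n%:~R| ^+ s) x.
Proof.
move=> sr; apply: bounded_sum_le => n.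
have [->|n0] := eqVneq n 0; first by rewrite a0 cmod0 !mul0r.
rewrite ler_wpM2l ?cmod_ge0 // ler_weXn2l //.
by rewrite -intr_norm (ler_int R 1); lia.
Qed.

Lemma sum_pow_le (p q t : R) (s : nat) : 0 <= p -> 0 <= q -> 0 <= t ->
  t <= p + q -> t ^+ s <= 2 ^+ s * (p ^+ s + q ^+ s).
Proof.
move=> p0 q0 t0 tpq.
have [pq|/ltW qp] := leP p q.
  apply: (@le_trans _ _ ((2 * q) ^+ s)).
    by rewrite lerXn2r ?nnegrE ?mulr_ge0 //; lra.
  by rewrite exprMn ler_wpM2l ?exprn_ge0 // lerDr exprn_ge0.
apply: (@le_trans _ _ ((2 * p) ^+ s)).
  by rewrite lerXn2r ?nnegrE ?mulr_ge0 //; lra.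
by rewrite exprMn ler_wpM2l ?exprn_ge0 // lerDl exprn_ge0.
Qed.

Lemma eigenvector_decay (r : nat) (y : R) (m : int) (u : int -> R[i]) :
  bounded_sum (fun n => cmod (a n) * `|n%:~R| ^+ r) x ->
  `|y - m%:~R| <= 4 * (x + B) + 2 ->
  (forall n, cmod (u n) <= 1) -> (forall n, L0b a b u n = y%:C * u n) ->
  forall s n, (s <= r.+1)%N ->
    `|(n - m)%:~R| ^+ s * cmod (u n) <= decay_const B s x.
Proof.
move=> ar ym u1 u_eig; elim=> [|s IH] n sr; first by rewrite mul1r.
have sr' : (s <= r)%N by [].
have as' := weighted_bound_le sr' ar.
have ax := weighted_bound_le (leq0n r) ar.
have x0 : 0 <= x.
  by apply: bounded_sum_ge0 ar => k; rewrite mulr_ge0 ?cmod_ge0 ?exprn_ge0.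
have B0 : 0 <= B by exact: le_trans (bB 0).
have D0 : 0 <= decay_const B s x.
  by apply: le_trans (IH m (leqW sr')); rewrite mulr_ge0 ?exprn_ge0 ?cmod_ge0.
rewrite [decay_const _ _ _]/=; set D := decay_const B s x in IH D0 *.
set t : R := `|(n - m)%:~R|.
have t0 : 0 <= t by exact: normr_ge0.
(* The equation recentred at [m]: besides the convolution there remain [b n], bounded by [B], and
   the displacement [y - m]. *)
have eqn : (m%:~R - n%:~R) * u n = csumZ (fun k => a (n - k) * u k)
    + ((b n)%:C - (y - m%:~R)%:C) * u n.
  have := u_eig n; rewrite /L0b /L0 rmorphB /= rmorph_int => h.
  have -> : csumZ (fun k => a (n - k) * u k) =
    y%:C * u n - (b n)%:C * u n - n%:~R * u n by rewrite -h; ring.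
  ring.
have h1 : t * cmod (u n) <= cmod (csumZ (fun k => a (n - k) * u k)) +
    (4 * (x + B) + 2 + B) * cmod (u n).
  rewrite /t -cmod_intr -cmodM intrB -opprB mulNr cmodN eqn.
  rewrite (le_trans (ler_cmodD _ _)) // lerD2l cmodM ler_wpM2r ?cmod_ge0 //.
  rewrite (le_trans (ler_cmodB _ _)) // !cmod_real addrC lerD //.
have shift (f : int -> R) M : (forall k, 0 <= f k) -> bounded_sum f M ->
    bounded_sum (fun k => f (n - k)) M.
  move=> f0 fM; apply: (bounded_sum_inj (h := fun k => n - k) f0 _ fM).
  by move=> i j /addrI/oppr_inj.
have h2 : t ^+ s * cmod (csumZ (fun k => a (n - k) * u k)) <=
    2 * (2 ^+ s * (x + x * D)).
  have ts0 : 0 <= t ^+ s by exact: exprn_ge0.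
  have xD0 : 0 <= x + x * D by rewrite addr_ge0 ?mulr_ge0.
  (* The weight is divided out because [csumZ_le] wants a majorant of the summands themselves; its
     factor 2 turns [2 ^+ s] into the [2 ^+ s.+1] of [decay_const]. *)
  have [->|ts] := eqVneq (t ^+ s) 0.
    by rewrite mul0r !mulr_ge0 ?exprn_ge0.
  have {ts}ts : 0 < t ^+ s by rewrite lt_def ts.
  rewrite mulrC -ler_pdivlMr // -mulrA [_ * (t ^+ s)^-1]mulrC.
  apply: (csumZ_le (g := fun k => (t ^+ s)^-1 * (2 ^+ s *
    (cmod (a (n - k)) * `|(n - k)%:~R| ^+ s + D * (cmod (a (n - k)) * `|(n - k)%:~R| ^+ 0))))).
    move=> k; rewrite ler_pdivlMl // cmodM expr0 mulr1.
    have h3 : `|(n - m)%:~R| ^+ s <= 2 ^+ s * (`|(n - k)%:~R| ^+ s + `|(k - m)%:~R| ^+ s) :> R.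
      apply: sum_pow_le => //.
      rewrite -(_ : n%:~R - k%:~R + (k%:~R - m%:~R) = (n - m)%:~R :> R).
        by rewrite !intrB ler_normD.
      by rewrite intrB; ring.
    have := ler_wpM2r (mulr_ge0 (cmod_ge0 (a (n - k))) (cmod_ge0 (u k))) h3.
    move=> /le_trans; apply; rewrite -!mulrA ler_wpM2l ?exprn_ge0 //.
    have h4 := ler_wpM2l (cmod_ge0 (a (n - k))) (IH k (leqW sr')).
    have h5 : `|(n - k)%:~R| ^+ s * cmod (a (n - k)) * cmod (u k) <=
        `|(n - k)%:~R| ^+ s * cmod (a (n - k)).
      by rewrite ler_piMr // mulr_ge0 ?exprn_ge0 ?cmod_ge0.
    by lra.
  apply: bounded_sumZ; first by rewrite invr_ge0.
  apply: bounded_sumZ; first by rewrite exprn_ge0.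
  apply: bounded_sumD; last rewrite [x * D]mulrC; last apply: bounded_sumZ => //.
    apply: (shift (fun k => cmod (a k) * `|k%:~R| ^+ s)) as' => k.
    by rewrite mulr_ge0 ?exprn_ge0 ?cmod_ge0.
  apply: (shift (fun k => cmod (a k) * `|k%:~R| ^+ 0)) ax => k.
  by rewrite mulr_ge0 ?exprn_ge0 ?cmod_ge0.
rewrite exprSr -mulrA.
have := ler_wpM2l (exprn_ge0 s t0) h1.
have := IH n (leqW sr'); rewrite -/t => h3.
rewrite exprSr; have : (0 : R) <= 4 * (x + B) + 2 + B by lra.
move=> /ler_wpM2l/(_ _ _ h3); lra.
Qed.

End Decay.

(** * The unitary group *)

Section EllTwo.
Variable R : realType.
Implicit Types (u v : int -> R[i]) (z : R[i]).

Lemma ell2P u : ell2 u <-> exists M, bounded_sum (fun n => cmod (u n) ^+ 2) M.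
Proof.
split=> [u2|[M uM]]; last exact: (bounded_sum_lt_pinfty (fun n => sqr_ge0 _) uM).
exists (fine (\esum_(n in [set: int]) (cmod (u n) ^+ 2)%:E)).
exact: (esum_bounded_sum (fun n => sqr_ge0 (cmod (u n))) u2).
Qed.

Lemma ell2_lin z u v : ell2 u -> ell2 v -> ell2 (fun n => z * u n + v n).
Proof.
move=> /ell2P[M uM] /ell2P[N vN]; apply/ell2P.
exists (2 * cmod z ^+ 2 * M + 2 * N).
have zz : 0 <= 2 * cmod z ^+ 2 by rewrite mulr_ge0 ?sqr_ge0.
have two : 0 <= 2 :> R by [].
apply: bounded_sum_le (bounded_sumD (bounded_sumZ zz uM) (bounded_sumZ two vN)) => n.
by rewrite (le_trans (sqr_cmodD _ _)) // cmodM exprMn mulrA.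
Qed.

Lemma ell2_cst0 : ell2 (fun=> 0 : R[i]).
Proof.
by apply/ell2P; exists 0 => L; rewrite big1 // => n _; rewrite cmod0 expr0n.
Qed.

Lemma sqr_norm2_le u M : bounded_sum (fun n => cmod (u n) ^+ 2) M ->
  norm2 u ^+ 2 <= M.
Proof.
move=> uM; rewrite /norm2 sqr_sqrtr.
  exact: (fine_esum_le (fun n => sqr_ge0 (cmod (u n)))).
by rewrite fine_ge0 // esum_ge0 // => n _; rewrite lee_fin sqr_ge0.
Qed.

Lemma cmod_le_norm2 u n : ell2 u -> cmod (u n) <= norm2 u.
Proof.
move=> u2; rewrite -(ler_pXn2r (n := 2)) ?nnegrE ?cmod_ge0 ?sqrtr_ge0 //.
rewrite /norm2 sqr_sqrtr; last first.
  by rewrite fine_ge0 // esum_ge0 // => k _; rewrite lee_fin sqr_ge0.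
apply: (bounded_sum_term (f := fun k => cmod (u k) ^+ 2)).
  by move=> k; exact: sqr_ge0.
exact: (esum_bounded_sum (fun n => sqr_ge0 (cmod (u n))) u2).
Qed.

Lemma Re_inner_self u : complex.Re (inner u u) = norm2 u ^+ 2.
Proof.
have sq n : complex.Re (u n * conjc (u n)) = cmod (u n) ^+ 2 by rewrite mulcJ.
rewrite /norm2 sqr_sqrtr; last first.
  by rewrite fine_ge0 // esum_ge0 // => k _; rewrite lee_fin sqr_ge0.
rewrite /= /sumZ [X in _ - fine X]esum1 ?subr0 => [|n _]; last first.
  by rewrite sq max_r // oppr_le0 sqr_ge0.
by congr fine; apply: eq_esum => n _; rewrite sq max_l // sqr_ge0.
Qed.

Lemma inner_delta u n : inner u (delta R n) = u n.
Proof.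
have f0 k : k != n -> u k * conjc (delta R n k) = 0.
  by move=> kn; rewrite /delta (negbTE kn) conjc0 mulr0.
have fn : u n * conjc (delta R n n) = u n.
  by rewrite /delta eqxx conjc1 mulr1.
apply: (csumZ_eq (g := fun k => cmod (u k * conjc (delta R n k))) (M := cmod (u n))).
- by [].
- move=> L; have [nL|nL] := boolP (n \in window L).
    by rewrite (sum_window_delta (k := n)) ?fn // => k /f0->; rewrite cmod0.
  rewrite big1_seq ?cmod_ge0 // => k /andP[_ kL].
  by rewrite f0 ?cmod0 //; apply: contraNneq nL => <-.
move=> L e hL; have [nL|nL] := boolP (n \in window L).
  rewrite (sum_window_delta (k := n)) ?fn // subrr cmod0.
  by have := hL [::] isT; rewrite big_nil; apply.
rewrite big1_seq => [|k /andP[_ kL]]; last first.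
  by rewrite f0 //; apply: contraNneq nL => <-.
rewrite subr0; have := hL [:: n] isT; rewrite big_seq1 fn; apply.
by move=> k; rewrite inE => /eqP->.
Qed.

End EllTwo.

Section UnitaryGroup.
Variables (R : realType) (D : set (int -> R[i])).
Variables (H : (int -> R[i]) -> int -> R[i]).
Variables (U : R -> (int -> R[i]) -> int -> R[i]).
Hypothesis HU : unitary_group_of D H U.

(** Carrying the extra vector [v] makes the induction run on the identity for [z * u + v] alone,
    with [v] as its base case. *)
Lemma unitary_sum t (I : Type) (s : seq I) (c : I -> R[i])
    (f : I -> int -> R[i]) v n : (forall i, ell2 (f i)) -> ell2 v ->
  U t (fun j => \sum_(i <- s) c i * f i j + v j) n =
  \sum_(i <- s) c i * U t (f i) n + U t v n.
Proof.
case: HU => _ Ulin _ _ _ f2 v2.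
have s2 (r : seq I) : ell2 (fun j => \sum_(i <- r) c i * f i j + v j).
  elim: r => [|i r IH].
    by under eq_fun do rewrite big_nil add0r.
  under eq_fun do rewrite big_cons -addrA.
  exact: ell2_lin.
elim: s => [|i s IH].
  rewrite big_nil add0r; congr (U t _ n).
  by apply/funext => j; rewrite big_nil add0r.
rewrite big_cons -addrA -IH -Ulin //; congr (U t _ n).
by apply/funext => j; rewrite big_cons addrA.
Qed.

(* The squared modulus of [t |-> U t phi n] has zero derivative, because
   [U (t + h) phi - U t phi = h (- 'i mu U t phi + o(1))] with a remainder
   whose norm does not depend on [t]. *)
Lemma cmod_unitary_eigenvector (mu : R) (phi : int -> R[i]) t n :
  ell2 phi -> eigspace D H mu%:C phi -> cmod (U t phi n) = cmod (phi n).
Proof.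
case: HU => Uiso Ulin Ugrp _ Ugen phi2 [Dphi Hphi].
pose z : R[i] := - 'i%C * mu%:C; pose w j := z * phi j.
have w2 : ell2 w.
  have := ell2_lin z phi2 (@ell2_cst0 R).
  by under eq_fun do rewrite addr0.
pose q h j := (U h phi j - phi j) / h%:C - w j.
have q2 h : ell2 (q h).
  have -> : q h = (fun j => (h%:C)^-1 * (-1 * phi j + U h phi j) +
      (- z * phi j + 0)).
    by apply/funext => j; rewrite /q /w; ring.
  apply: ell2_lin; first by apply: ell2_lin => //; exact: (Uiso h phi phi2).1.
  by apply: ell2_lin => //; exact: ell2_cst0.
have q_lim : norm2 (q h) @[h --> (0 : R)^'] --> (0 : R).
  apply/(Ugen phi w phi2 w2); split => // j.
  by rewrite /w /z Hphi mulrA.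
have step (s h : R) : h != 0 -> exists2 rho : R[i], cmod rho <= norm2 (q h) &
    U (s + h) phi n = U s phi n + h%:C * (z * U s phi n + rho).
  move=> h0; exists (U s (q h) n).
    have [Uq2 <-] := Uiso s _ (q2 h); exact: cmod_le_norm2.
  have hC : h%:C != 0 :> R[i] by rewrite eq_complex /= negb_and h0.
  rewrite (Ugrp phi phi2).2.
  have -> : U h phi = (fun j => h%:C * (z * phi j + q h j) + phi j).
    by apply/funext => j; rewrite /q /w; field.
  rewrite Ulin //; last exact: ell2_lin.
  by rewrite Ulin // addrC.
pose N := norm2 phi.
have gN s : cmod (U s phi n) <= N.
  have [U2 UN] := Uiso s _ phi2; rewrite /N -UN; exact: cmod_le_norm2.
pose f s := cmod (U s phi n) ^+ 2.
pose E h := `|h| * (mu ^+ 2 * N ^+ 2 + norm2 (q h) ^+ 2) +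
  2 * (1 + `|h| * `|mu|) * N * norm2 (q h).
have E_lim : E h @[h --> (0 : R)^'] --> (0 : R).
  have h_lim : `|h| @[h --> (0 : R)^'] --> (0 : R).
    by rewrite -[X in _ --> X](@normr0 R R); apply: cvg_norm; exact: nbhs_dnbhs.
  rewrite -[X in _ --> X](_ : 0 * (mu ^+ 2 * N ^+ 2 + 0 * 0) +
    2 * (1 + 0 * `|mu|) * N * 0 = _); last by ring.
  rewrite /E; under eq_fun do rewrite [norm2 (q _) ^+ 2]expr2.
  apply: cvgD; apply: cvgM => //.
    by apply: cvgD; [exact: cvg_cst|exact: cvgM].
  apply: cvgM; last exact: cvg_cst.
  apply: cvgM; first exact: cvg_cst.
  by apply: cvgD; [exact: cvg_cst|apply: cvgM => //; exact: cvg_cst].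
have f_diff s h : h != 0 -> `|h^-1 * (f (h + s) - f s)| <= E h.
  move=> h0; have [rho rho_le e] := step s h h0.
  pose g := U s phi n; pose c := g * conjc rho.
  have cE : cmod c = cmod g * cmod rho by rewrite cmodM cmod_conj.
  (* As [z] is purely imaginary, the first-order term [2 Re(z) |g|^2] vanishes; every remaining term
     contains [rho] or a factor [h]. *)
  have -> : h^-1 * (f (h + s) - f s) = 2 * complex.Re c + h * (mu ^+ 2 * cmod g ^+ 2
      + 2 * (mu * complex.Im c) + cmod rho ^+ 2).
    rewrite /f (addrC h s) e -/g !sqr_cmod /c /z.
    by case: (g) => p1 p2; case: (rho) => r1 r2 /=; field.
  have gN' := gN s; rewrite -/g in gN'.
  have g0 := cmod_ge0 g; have rho0 := cmod_ge0 rho.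
  have c_le : cmod c <= N * norm2 (q h) by rewrite cE ler_pM.
  have b1 : `|complex.Re c| <= N * norm2 (q h) := le_trans (ler_Re_cmod c) c_le.
  have b2 : `|complex.Im c| <= N * norm2 (q h) := le_trans (ler_Im_cmod c) c_le.
  have b3 : mu ^+ 2 * cmod g ^+ 2 <= mu ^+ 2 * N ^+ 2.
    by rewrite ler_wpM2l ?sqr_ge0 // lerXn2r ?nnegrE // (le_trans g0).
  have b4 : cmod rho ^+ 2 <= norm2 (q h) ^+ 2.
    by rewrite lerXn2r ?nnegrE // (le_trans rho0).
  have b5 : `|mu * complex.Im c| <= `|mu| * (N * norm2 (q h)).
    by rewrite normrM ler_wpM2l.
  have b6 : `|mu ^+ 2 * cmod g ^+ 2 + 2 * (mu * complex.Im c) + cmod rho ^+ 2| <=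
      mu ^+ 2 * N ^+ 2 + 2 * (`|mu| * (N * norm2 (q h))) + norm2 (q h) ^+ 2.
    rewrite (le_trans (ler_normD _ _)) // lerD //; last by rewrite ger0_norm ?sqr_ge0.
    rewrite (le_trans (ler_normD _ _)) // lerD //.
      by rewrite ger0_norm // mulr_ge0 ?sqr_ge0.
    by rewrite normrM ger0_norm // ler_wpM2l.
  rewrite (le_trans (ler_normD _ _)) // !normrM (ger0_norm (ler0n R 2)).
  by have := ler_wpM2l (normr_ge0 h) b6; rewrite /E; lra.
have f_der s : is_derive s (1 : R) f 0.
  have lim : h^-1 *: (f (h *: (1 : R) + s) - f s) @[h --> (0 : R)^'] --> (0 : R).
    apply/norm_cvg0P; apply: (@squeeze_cvgr _ _ _ _ (fun=> 0) E) => //; last exact: cvg_cst.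
    near=> h; rewrite normr_ge0 /= scaler1 f_diff //.
    by near: h; exact: nbhs_dnbhs_neq.
  by apply: DeriveDef; [apply/cvg_ex; exists 0|apply/cvg_lim].
have := is_derive_0_is_cst t 0 f_der.
rewrite /f (Ugrp phi phi2).1 => e.
apply/eqP; rewrite -(eqrXn2 (n := 2)) ?cmod_ge0 //; exact/eqP.
Unshelve. all: by end_near. Qed.

End UnitaryGroup.

(** * Decay of the evolved basis vectors and bounds on moments *)

Section Localization.
Variables (R : realType) (U : R -> (int -> R[i]) -> int -> R[i]).
Variables (D : set (int -> R[i])) (H : (int -> R[i]) -> int -> R[i]).
Variables (mu : int -> R) (phi : int -> int -> R[i]) (r : nat) (A : R).
Hypothesis HU : unitary_group_of D H U.
Hypothesis phi2 : forall m, ell2 (phi m).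
Hypothesis phi_eig : forall m, eigspace D H (mu m)%:C (phi m).
Hypothesis phi_complete : forall k (e : R), 0 < e -> exists M0, forall M,
  (M0 <= M)%N -> bounded_sum (fun n => cmod (delta R k n -
    \sum_(m <- window M) conjc (phi m k) * phi m n) ^+ 2) e.
Hypothesis r_gt0 : (0 < r)%N.
Hypothesis phi_decay : forall m n,
  (1 + `|(n - m)%:~R|) ^+ r.+1 * cmod (phi m n) <= A.

Let A_ge0 : 0 <= A.
Proof.
by apply: le_trans (phi_decay 0 0); rewrite mulr_ge0 ?exprn_ge0 ?cmod_ge0 ?addr_ge0.
Qed.

(** [2 ^+ r.+1] from splitting the weight, [A * A] from two eigenvector entries, [4 + 4] from two
    translates of [invsq]. *)
Let Q := 2 ^+ r.+1 * (A * A * (4 + 4)).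

(** After splitting [|n - k|] at [m], the full weight is absorbed by one of the two entries; the
    other still decays to second order because [r > 0], which makes the sum over [m] finite. *)
Let term_le k n m : (1 + `|(n - k)%:~R|) ^+ r.+1 *
    (cmod (phi m k) * cmod (phi m n)) <=
  2 ^+ r.+1 * (A * A * (invsq R (k - m) + invsq R (n - m))).
Proof.
have w_le : 1 + `|(n - k)%:~R| <= (1 + `|(n - m)%:~R|) + (1 + `|(k - m)%:~R|) :> R.
  have := ler_normB ((n - m)%:~R : R) (k - m)%:~R; rewrite -intrB.
  by rewrite (_ : n - m - (k - m) = n - k) ?addrKA ?opprB ?addrA ?subrK //; lra.
have p0 : 0 < 1 + `|(n - m)%:~R| :> R by rewrite ltr_pwDl.
have q0 : 0 < 1 + `|(k - m)%:~R| :> R by rewrite ltr_pwDl.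
have sq j : cmod (phi m j) <= A * invsq R (j - m).
  rewrite /invsq ler_pdivlMr ?exprn_gt0 ?ltr_pwDl // mulrC.
  apply: le_trans (phi_decay m j); rewrite ler_wpM2r ?cmod_ge0 //.
  by rewrite ler_weXn2l // lerDl.
have h1 := phi_decay m n; have h2 := phi_decay m k.
have k0 := cmod_ge0 (phi m k); have n0 := cmod_ge0 (phi m n).
have := ler_wpM2r (mulr_ge0 k0 n0)
  (sum_pow_le r.+1 (ltW p0) (ltW q0) (addr_ge0 ler01 (normr_ge0 _)) w_le).
move=> /le_trans; apply; rewrite -[leLHS]mulrA ler_wpM2l ?exprn_ge0 //.
have h3 := ler_wpM2l k0 h1; have h4 := ler_wpM2l n0 h2.
have h5 := ler_wpM2l A_ge0 (sq k); have h6 := ler_wpM2l A_ge0 (sq n).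
by move: (1 + _) (1 + _) h3 h4 h5 h6 => ? ?; lra.
Qed.

Lemma propagation_decay k t n :
  (1 + `|(n - k)%:~R|) ^+ r.+1 * cmod (U t (delta R k) n) <= Q.
Proof.
set W := (1 + _) ^+ r.+1.
have W0 : 0 < W by rewrite exprn_gt0 // ltr_pwDl.
rewrite mulrC -ler_pdivlMr //; apply/ler_addgt0Pl => e e0.
(* The remainder [v] has norm at most [e]; the isometry keeps this bound at time [t], and it
   dominates the coordinate at [n]. *)
have [M /(_ M (leqnn M)) hM] := phi_complete k (exprn_gt0 2 e0).
pose v j := delta R k j - \sum_(m <- window M) conjc (phi m k) * phi m j.
have v2 : ell2 v by apply/ell2P; exists (e ^+ 2).
have -> : delta R k = fun j => \sum_(m <- window M) conjc (phi m k) * phi m j + v j.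
  by apply/funext => j; rewrite /v addrC subrK.
rewrite (unitary_sum HU) // (le_trans (ler_cmodD _ _)) // addrC lerD //.
  have [Uv2 Uv] : ell2 (U t v) /\ norm2 (U t v) = norm2 v by case: HU => h *; exact: h.
  apply: le_trans (cmod_le_norm2 n Uv2) _; rewrite Uv.
  rewrite -(ler_pXn2r (n := 2)) ?nnegrE ?sqrtr_ge0 ?(ltW e0) //.
  exact: sqr_norm2_le.
rewrite ler_pdivlMr // mulrC.
apply: (@le_trans _ _ (\sum_(m <- window M) W * (cmod (phi m k) * cmod (phi m n)))).
  rewrite -mulr_sumr ler_wpM2l ?(ltW W0) // (le_trans (ler_cmod_sum _ _ _)) //.
  apply: ler_sum => m _; rewrite cmodM cmod_conj.
  by rewrite (cmod_unitary_eigenvector HU _ _ (phi2 m) (phi_eig m)).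
apply: le_trans (ler_sum _ (fun m _ => term_le k n m)) _.
rewrite -mulr_sumr ler_wpM2l ?exprn_ge0 // -mulr_sumr ler_wpM2l ?mulr_ge0 //.
by rewrite big_split lerD //; exact: bounded_sum_invsqBr.
Qed.

Lemma moment_bound k (q : R) : 0 < q -> q <= 2 * r%:R ->
  (ereal_sup (range (fun t : R => \esum_(n in [set: int])
     (`|n%:~R| `^ q * cmod (inner (U t (delta R k)) (delta R n)) ^+ 2)%:E)) < +oo)%E.
Proof.
move=> q0 qr.
(* With [w = 1 + |n - k|] one has [|n| <= c * w]. Of the [2 (r + 1)] powers of [w] in the squared
   decay, [2 r] pay for the moment and two are left to sum. *)
pose c : R := 1 + `|k%:~R|.
have c1 : 1 <= c by rewrite lerDl.
have : ((c ^+ (2 * r) * Q ^+ 2 * 4)%:E < +oo)%E by rewrite ltry.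
apply: le_lt_trans; apply: ge_ereal_sup => _ [t _ <-].
apply: esum_window_le => [n|]; first by rewrite mulr_ge0 ?powR_ge0 ?sqr_ge0.
have cQ : 0 <= c ^+ (2 * r) * Q ^+ 2.
  by rewrite mulr_ge0 ?sqr_ge0 ?exprn_ge0 // (le_trans ler01).
apply: bounded_sum_le (bounded_sumZ cQ (bounded_sum_invsqB R k)) => n.
rewrite inner_delta; pose w : R := 1 + `|(n - k)%:~R|.
have w1 : 1 <= w by rewrite lerDl.
have w0 : 0 < w by rewrite (lt_le_trans ltr01).
have cw1 : 1 <= c * w by rewrite mulr_ege1.
have n_le : `|n%:~R| <= c * w.
  have : `|n%:~R| <= `|k%:~R| + `|(n - k)%:~R| :> R.
    rewrite -[X in `|X%:~R|](_ : k + (n - k) = n) ?intrD ?ler_normD //.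
    by rewrite addrC subrK.
  have : 0 <= `|k%:~R| * `|(n - k)%:~R| :> R by rewrite mulr_ge0.
  by rewrite /c /w; lra.
have pow : `|n%:~R| `^ q <= (c * w) ^+ (2 * r).
  rewrite -powR_mulrn; last by rewrite (le_trans ler01).
  apply: (@le_trans _ _ ((c * w) `^ q)).
    by rewrite ge0_ler_powR ?nnegrE ?(ltW q0) // (le_trans ler01).
  by rewrite ler_powR // natrM.
have Ud := propagation_decay k t n; rewrite -/w in Ud.
have Q0 : 0 <= Q.
  by apply: le_trans Ud; rewrite mulr_ge0 ?exprn_ge0 ?cmod_ge0 // ltW.
have Ud2 : (w ^+ r.+1) ^+ 2 * cmod (U t (delta R k) n) ^+ 2 <= Q ^+ 2.
  by rewrite -exprMn lerXn2r ?nnegrE // mulr_ge0 ?exprn_ge0 ?cmod_ge0 // ltW.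
apply: le_trans (ler_wpM2r (sqr_ge0 _) pow) _.
have c0 : 0 <= c by exact: le_trans ler01 c1.
rewrite exprMn /invsq -/w -[leLHS]mulrA -[leRHS]mulrA ler_wpM2l ?exprn_ge0 //.
rewrite ler_pdivlMr ?exprn_gt0 //; apply: le_trans Ud2.
rewrite le_eqVlt; apply/orP; left; apply/eqP.
by rewrite -exprM mulrAC; congr (_ * _); rewrite -exprD -mulnSr mulnC.
Qed.

End Localization.

Lemma wnorm1_natE (R : realType) (r : nat) (a : int -> R[i]) :
  wnorm1 r%:R a = \esum_(m in [set: int]) (cmod (a m) * `|m%:~R| ^+ r)%:E.
Proof. by apply: eq_esum => m _; rewrite powR_mulrn. Qed.

Theorem theorem1p4 (R : realType) (b : int -> R) 
    (hb : exists B : R, forall n : int, `|b n| <= B) :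
  exists gam : nat -> R -> R,
  forall (a : int -> R[i]) (r0 : R) (lam : int -> R),
    a 0 = 0 -> (forall m : int, a m = conjc (a (- m))) ->
    0 <= r0 -> ell1 r0 a ->
    eigenvalue_enum (@domL0 R) (L0b a b) lam ->
  [/\ exists2 g : R, 0 < g & forall n : int, `|lam n - n%:~R| <= g,
      forall r : nat, ell1 r%:R a ->
        forall phi : int -> int -> R[i],
          orthonormal_basis phi ->
          (forall m : int,
            eigspace (@domL0 R) (L0b a b) (lam m)%:C (phi m)) ->
        forall m n : int, n != m ->
          cmod (phi m n) <=
            gam r (fine (wnorm1 r%:R a)) / `|(n - m)%:~R| ^+ r.+1
    & forall r : nat, ell1 r%:R a ->
        forall q : R, 0 < q -> q < 2 * r%:R - 1 ->
        forall (k : int) (U : R -> (int -> R[i]) -> int -> R[i]),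
          unitary_group_of (@domL0 R) (L0b a b) U ->
        (ereal_sup (range (fun t : R =>
           \esum_(n in [set: int])
             (`|n%:~R| `^ q *
              cmod (inner (U t (@delta R k)) (@delta R n)) ^+ 2)%:E)) < +oo)%E].
Proof.
have [B bB] := hb; have B0 : 0 <= B by exact: le_trans (bB 0).
(* Chosen before [a]: only [r], the norm and the bound [B] of the fixed [b] enter. *)
exists (fun r x => decay_const B r.+1 x) => a r0 lam a0 aH r0_ge0 a_r0 lam_enum.
have wpos r n : 0 <= cmod (a n) * `|n%:~R| ^+ r :> R.
  by rewrite mulr_ge0 ?cmod_ge0 ?exprn_ge0.
have weight r : ell1 r%:R a ->
    bounded_sum (fun n => cmod (a n) * `|n%:~R| ^+ r) (fine (wnorm1 r%:R a)).
  by rewrite /ell1 /= wnorm1_natE => ar; exact: (esum_bounded_sum (wpos r)).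
have weight0 x r : bounded_sum (fun n => cmod (a n) * `|n%:~R| ^+ r) x ->
    bounded_sum (fun n => cmod (a n)) x.
  move=> /(weighted_bound_le a0 (leq0n r)).
  by apply: bounded_sum_le => n; rewrite expr0 mulr1.
have [x ax] : exists x, bounded_sum (fun n => cmod (a n)) x.
  exists (fine (wnorm1 r0 a)).
  apply: bounded_sum_le (esum_bounded_sum _ a_r0) => n; last first.
    by rewrite mulr_ge0 ?cmod_ge0 ?powR_ge0.
  have [->|n0] := eqVneq n 0; first by rewrite a0 cmod0 mul0r.
  have n1 : 1 <= `|n%:~R| :> R by rewrite -intr_norm (ler_int R 1); lia.
  by rewrite ler_peMr ?cmod_ge0 //; have := ler_powR n1 r0_ge0; rewrite powRr0.
have x0 : 0 <= x by apply: bounded_sum_ge0 ax => n; exact: cmod_ge0.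
split.
- exists (4 * (x + B) + 2); first by lra.
  exact: (eigenvalue_shift aH ax bB lam_enum).
- move=> r /weight ar phi [phi2 phi_on _] phi_eig m n nm.
  have nm0 : 0 < `|(n - m)%:~R| :> R by rewrite normr_gt0 intr_eq0 subr_eq0.
  rewrite ler_pdivlMr ?exprn_gt0 // mulrC.
  apply: (eigenvector_decay a0 bB ar) => //.
  + exact: (eigenvalue_shift aH (weight0 _ _ ar) bB lam_enum).
  + move=> j; apply: le_trans (cmod_le_norm2 j (phi2 m)) _.
    rewrite -(ler_pXn2r (n := 2)) ?nnegrE ?sqrtr_ge0 //.
    by rewrite -Re_inner_self phi_on eqxx expr1n.
  + by case: (phi_eig m).
move=> r /weight ar q q0 qr k U HU.
(* [0 < q < 2 r - 1] is impossible for [r = 0]. *)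
have r_gt0 : (0 < r)%N by rewrite lt0n; apply: contraTneq qr => ->; rewrite -leNgt; lra.
have [mu [phi [mu_phi phi_eig _ phi_complete _]]] :=
  exists_eigenbasis aH (weight0 _ _ ar) bB.
have xB0 : 0 <= fine (wnorm1 r%:R a) + B.
  by apply: le_trans (proj1 (mu_phi 0)).
(* [A] bounds the shifted weight: [(1 + t)^(r+1) <= 2^(r+1) (1 + t^(r+1))], where the 1 is paid by
   entries of modulus at most 1 and the power by the decay. *)
apply: (moment_bound (A := 2 ^+ r.+1 * (1 + decay_const B r.+1 (fine (wnorm1 r%:R a))))
  HU _ phi_eig phi_complete r_gt0) => //; last by lra.
  by move=> m; case: (phi_eig m) => [[]].
move=> m n; have [mu_m phi1] := mu_phi m; have [_ eig_m] := phi_eig m.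
have decay : `|(n - m)%:~R| ^+ r.+1 * cmod (phi m n) <=
    decay_const B r.+1 (fine (wnorm1 r%:R a)).
  by apply: (eigenvector_decay a0 bB ar _ phi1 eig_m) => //; lra.
have pow : (1 + `|(n - m)%:~R|) ^+ r.+1 <=
    2 ^+ r.+1 * (1 ^+ r.+1 + `|(n - m)%:~R| ^+ r.+1) :> R.
  by apply: sum_pow_le; rewrite ?addr_ge0.
apply: le_trans (ler_wpM2r (cmod_ge0 _) pow) _.
rewrite -mulrA ler_wpM2l ?exprn_ge0 // mulrDl expr1n mul1r lerD //.
Qed.
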